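(* Let $f\in C(\mathbb{R};\mathbb{R})$ satisfy $xf(x)>0$ for all $x\ne0$ and $f(0)=0$. Let $\sigma\in C([0,\infty);\mathbb{R})$ be such that $t\mapsto\sigma^2(t)$ is decreasing. For each $\xi\in\mathbb{R}$ let $X(\cdot,\xi)$ be any solution of $$dX(t)=-f(X(t))\,dt+\sigma(t)\,dB(t),\quad t\ge0;\qquad X(0)=\xi.$$ Then the following are equivalent: (A) $\lim_{t\to\infty}\sigma^2(t)\log t=0$; (B) $\lim_{t\to\infty}X(t,\xi)=0$ a.s. for each $\xi\in\mathbb{R}$.
   Context: $(\Omega,\mathcal{F},(\mathcal{F}(t))_{t\ge0},\mathbb{P})$ is a complete filtered probability space and $B$ a standard one-dimensional Brownian motion adapted to the filtration. A solution is any continuous adapted process $X$ on $[0,\infty)$ with, a.s., $X(t)=\xi-\int_0^tf(X(s))\,ds+\int_0^t\sigma(s)\,dB(s)$ for all $t\ge0$; the initial value $\xi$ is deterministic and uniqueness is not assumed. *)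

(* Defs.v *)
From HB Require Import structures.
From mathcomp Require Export all_boot all_order all_algebra.
From mathcomp Require Export all_classical all_reals all_analysis.
Export Order.TTheory GRing.Theory Num.Theory.
Export numFieldNormedType.Exports.

Set Implicit Arguments.
Unset Strict Implicit.
Unset Printing Implicit Defensive.

Local Open Scope classical_set_scope.
Local Open Scope ring_scope.

(* Processes are indexed by R, but only the
   times t >= 0 are ever constrained or used. *)

Section processes.
Context (d : measure_display) (T : measurableType d) (R : realType)
  (P : probability T R).
Implicit Types (F : R -> set (set T)) (X B J : R -> T -> R).

(* The last clause is completeness: since every F t consists of measurable
   sets, it also makes the probability space (T, P) itself complete. *)
Definition complete_filtration F :=
  [/\ forall t, 0 <= t -> sigma_algebra setT (F t),
      forall t, 0 <= t -> F t `<=` measurable,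
      forall s t, 0 <= s -> s <= t -> F s `<=` F t &
      forall t, 0 <= t -> P.-negligible `<=` F t].

Definition adapted F X :=
  forall t, 0 <= t -> forall A : set R, measurable A -> F t (X t @^-1` A).

Definition continuous_process X :=
  {ae P, forall w, {within `[0, +oo[, continuous (X ^~ w)}}.

(* normal_prob takes the standard deviation as its second parameter.  Since the
   sets A i may be taken to be setT and the sequence of times may be eventually
   constant, the product rule below is the mutual independence of the
   increments over any finite number of consecutive intervals. *)
Definition brownian_motion B :=
  [/\ forall t, 0 <= t -> measurable_fun setT (B t),
      {ae P, forall w, B 0 w = 0},
      continuous_process B,
      forall s t, 0 <= s -> s < t -> forall A : set R, measurable A ->
        P ((fun w => B t w - B s w) @^-1` A) =
        normal_prob 0 (Num.sqrt (t - s)) A &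
      forall t : nat -> R, 0 <= t 0%N -> (forall n, t n <= t n.+1) ->
        forall (A : nat -> set R) (n : nat), (forall i, measurable (A i)) ->
        P [set w | forall i, (i < n)%N -> A i (B (t i.+1) w - B (t i) w)] =
        (\prod_(i < n) P ((fun w => (B (t i.+1) w - B (t i) w)%R) @^-1` A i))%E].

(* A list of triples (c, u, v) encodes the step function
   \sum c * 1_(]u, v]). *)
Definition step_fun (phi : seq (R * R * R)) (s : R) : R :=
  \sum_(p <- phi) p.1.1 * \1_(`]p.1.2, p.2]) s.

Definition step_on (t : R) (phi : seq (R * R * R)) : bool :=
  all (fun p => [&& 0 <= p.1.2, p.1.2 <= p.2 & p.2 <= t]) phi.

Definition step_integral B (phi : seq (R * R * R)) (w : T) : R :=
  \sum_(p <- phi) p.1.1 * (B p.2 w - B p.1.2 w).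

Definition step_approx (g : R -> R) (t : R) (phi : nat -> seq (R * R * R)) :=
  (forall n, step_on t (phi n)) /\
  (\int[lebesgue_measure]_(s in `[0%R, t])
      ((step_fun (phi n) s - g s) ^+ 2)%:E)%E @[n --> \oo] --> 0%E.

(* The Ito integral over [0, t] of a deterministic integrand g in L^2([0, t]):
   step functions are dense there, and j is the common limit in L^2(P) of the
   integrals of all sequences of step functions converging to g. *)
Definition stochastic_integral_at B (g : R -> R) (t : R) (j : T -> R) :=
  (exists phi, step_approx g t phi) /\
  forall phi, step_approx g t phi ->
    (\int[P]_w ((step_integral B (phi n) w - j w) ^+ 2)%:E)%E
      @[n --> \oo] --> 0%E.

(* J is a continuous adapted version of t |-> \int_0^t g(s) dB(s). *)
Definition stochastic_integral F B (g : R -> R) J :=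
  [/\ adapted F J, continuous_process J &
      forall t, 0 <= t -> stochastic_integral_at B g t (J t)].

Definition sde_solution F B (f sigma : R -> R) (xi : R) X :=
  [/\ adapted F X, continuous_process X &
      exists2 J, stochastic_integral F B sigma J &
        {ae P, forall w, forall t, 0 <= t ->
          X t w = xi - (\int[lebesgue_measure]_(s in `[0, t]) f (X s w))
                  + J t w}].

End processes.

(* Main.v *)
Require Import Defs.
From mathcomp Require Import measurable_realfun simple_functions ring lra zify.

(** The solution differs from the martingale J = int sigma dB by a drift which
    pushes towards 0.  Pathwise, X tends to 0 as soon as J oscillates little over
    unit time intervals and does not tend to +oo or to -oo: if X stayed away
    from 0 it would be driven back whenever it is bounded, and X -> +oo would
    force J -> +oo.  Conversely X -> 0 forces the unit increments of J to tend
    to 0.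

    All probabilistic facts come from the real exponential moments of J at
    finitely many times, obtained as limits of those of step integrals.
    They give subgaussian tails, hence by dyadic chaining and Borel-Cantelli the
    small oscillation of J under (A).  For the lower bounds, mean-one exponentials
    of increments (or of lacunary values) of J are almost uncorrelated, so a
    Chebyshev estimate on their weighted sums replaces independence: they cannot
    all stay below 1/4.  This excludes J -> +oo, and shows that increments
    tending to 0 force sum exp(- K^2 / v_n) < oo for every K > 0 with
    v_n = int_n^(n+1) sigma^2, that is (A). *)

Set Implicit Arguments.
Unset Strict Implicit.
Unset Printing Implicit Defensive.
Import HBNNSimple.
Local Open Scope classical_set_scope.
Local Open Scope ring_scope.

(** * Exponential moments of Brownian increments *)

(** Nothing is assumed on the size of [f] at infinity, where the restoring force may fade. The sign
    of [f] then only says that above 0 the solution grows no faster than [J], so escape to infinity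
    has to be excluded by a statement about [J] itself; once a path is known to be bounded, [f] has
    a positive minimum on the compact range left to it. The stochastic integral is given at each
    fixed time as a mean-square limit. Mean-square convergence passes to truncated exponentials, and
    a uniform bound on second exponential moments controls the truncation. Joint exponential moments
    with arbitrary real coefficients then carry both the variances and the decorrelation of
    increments. Monotonicity of [sigma ^+ 2] bounds the variance over an interval by the value at
    its left end, and it turns bounded sums of exp(- K^2 / v_n) into bounds of the form n exp(- K^2
    / v_n) <= M, whose logarithm gives (A) because [K] is arbitrary. *)

Section monotone_class.
Context (R : realType).

(** The sums see [W] and [D] only through the integrals of [W] over the events that [D] lies in a
    Borel set; hence these integrals determine those of [W * g (D)] for all measurable [g >= 0]. *)
Lemma cvg_weighted_simple (d : measure_display) (T : measurableType d)
    (mu : {measure set T -> \bar R}) (W D : T -> R) (g : R -> R)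
    (mg : measurable_fun [set: R] (fun x : R => (g x)%:E)) :
  measurable_fun setT W -> (forall x, 0 <= W x) ->
  measurable_fun setT D -> (forall x, 0 <= g x) ->
  (fun n => \sum_(y \in range (nnsfun_approx measurableT mg n))
     (y%:E * \int[mu]_x (W x *
        \1_(nnsfun_approx measurableT mg n @^-1` [set y]) (D x))%:E))%E @ \oo
  --> (\int[mu]_x (W x * g (D x))%:E)%E.
Proof.
move=> mW W0 mD g0.
set h := nnsfun_approx _ _.
have mind n y : measurable_fun setT (fun x => \1_(h n @^-1` [set y]) (D x) : R).
  by apply: measurableT_comp => //; exact: measurable_indic.
have hn n : (\sum_(y \in range (h n))
     (y%:E * \int[mu]_x (W x * \1_(h n @^-1` [set y]) (D x))%:E)
     = \int[mu]_x (W x * h n (D x))%:E)%E.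
  have range0 y : y \in range (h n) -> 0 <= y by rewrite inE => -[x _ <-].
  (* The absolute value makes the summand nonnegative for every real [y], as the exchange of sum and
     integral requires; on the range of [h n] it changes nothing. *)
  transitivity (\sum_(y \in range (h n)) \int[mu]_x
      (`|y| * (W x * \1_(h n @^-1` [set y]) (D x)))%:E)%E.
    apply: eq_fsbigr => y /range0 y0.
    rewrite ger0_norm//; under [RHS]eq_integral do rewrite EFinM.
    rewrite ge0_integralZl_EFin//.
    - by move=> x _; rewrite lee_fin mulr_ge0// indicE.
    - by apply/measurable_EFinP; apply: measurable_funM.
  rewrite -ge0_integral_fsum//; last 2 first.
    - by move=> y; apply/measurable_EFinP; do 2! apply: measurable_funM => //.
    - by move=> y x _; rewrite lee_fin !mulr_ge0// indicE.
  apply: eq_integral => x _.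
  rewrite fsumEFin// [in RHS]fimfunE; congr EFin.
  rewrite fsbig_distrr//=.
  by apply: eq_fsbigr => y /range0 y0; rewrite ger0_norm// mulrCA.
under eq_fun do rewrite hn.
have -> : (\int[mu]_x (W x * g (D x))%:E =
    \int[mu]_x limn (fun n => (W x * h n (D x))%:E))%E.
  apply: eq_integral => x _; apply/esym/cvg_lim => //.
  under eq_fun do rewrite EFinM.
  rewrite EFinM; apply: cvgeZl => //.
  have := @cvg_nnsfun_approx _ _ R setT measurableT _ mg.
  apply => //.
  by move=> y _; rewrite /= lee_fin.
apply: cvg_monotone_convergence => //.
- move=> n; apply/measurable_EFinP; apply: measurable_funM => //.
  exact: measurableT_comp.
- by move=> n x _; rewrite lee_fin mulr_ge0.
- move=> x _ m n mn; rewrite lee_fin ler_wpM2l//.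
  exact/lefP/nd_nnsfun_approx.
Qed.

(** Two instances are used: a constant weight against a normal density, which passes from the law of
    an increment to its moments, and a product of other factors against a constant, which splits off
    one factor. *)
Lemma eq_weighted_integral (d1 d2 : measure_display)
    (T1 : measurableType d1) (T2 : measurableType d2)
    (mu1 : {measure set T1 -> \bar R}) (mu2 : {measure set T2 -> \bar R})
    (W1 D1 : T1 -> R) (W2 D2 : T2 -> R) (g : R -> R) :
  measurable_fun setT W1 -> (forall x, 0 <= W1 x) -> measurable_fun setT D1 ->
  measurable_fun setT W2 -> (forall x, 0 <= W2 x) -> measurable_fun setT D2 ->
  (forall A : set R, measurable A ->
    (\int[mu1]_x (W1 x * \1_A (D1 x))%:E = \int[mu2]_x (W2 x * \1_A (D2 x))%:E)%E) ->
  measurable_fun setT g -> (forall x, 0 <= g x) ->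
  (\int[mu1]_x (W1 x * g (D1 x))%:E = \int[mu2]_x (W2 x * g (D2 x))%:E)%E.
Proof.
move=> mW1 W10 mD1 mW2 W20 mD2 H mg g0.
have mg' : measurable_fun [set: R] (fun x : R => (g x)%:E) by exact/measurable_EFinP.
have := cvg_weighted_simple (mu:=mu1) mg' mW1 W10 mD1 g0.
have := cvg_weighted_simple (mu:=mu2) mg' mW2 W20 mD2 g0.
under eq_fun => n do under eq_fsbigr => y _ do rewrite -H//.
by move=> /cvg_lim <-// /cvg_lim <-.
Qed.
End monotone_class.

Section normal_mgf.
Context (R : realType).
(** Completing the square: the exponential tilts the centred density into the one of mean [c * s],
    up to the factor on the right. *)
Lemma normal_mgf (s c : R) : 0 < s ->
  (\int[lebesgue_measure]_x (normal_pdf 0 (Num.sqrt s) x * expR (c * x))%:E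
   = (expR (c ^+ 2 * s / 2))%:E)%E.
Proof.
move=> s0; have ss0 : Num.sqrt s != 0 by rewrite gt_eqF ?sqrtr_gt0.
transitivity (\int[lebesgue_measure]_x
   ((expR (c ^+ 2 * s / 2))%:E * (normal_pdf (c * s) (Num.sqrt s) x)%:E))%E.
  apply: eq_integral => x _; rewrite -EFinM; congr EFin.
  rewrite !normal_pdfE// /normal_fun mulrCA -!mulrA -!expRD.
  congr (_ * expR _).
  by rewrite sqr_sqrtr ?ltW// -[s *+ 2]mulr_natl; field; lra.
rewrite ge0_integralZl_EFin//.
- by rewrite integral_normal_pdf mule1.
- by move=> x _; rewrite lee_fin normal_pdf_ge0.
- by apply/measurable_EFinP; exact: measurable_normal_pdf.
Qed.
End normal_mgf.

Section brownian_increments.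
Context (d : measure_display) (T : measurableType d) (R : realType)
  (P : probability T R) (B : R -> T -> R).
Hypothesis hB : brownian_motion P B.

Lemma brownian_measurable_incr s t : 0 <= s -> 0 <= t ->
  measurable_fun setT (fun w => B t w - B s w).
Proof.
by case: hB => mB _ _ _ _ s0 t0; apply: measurable_funB; exact: mB.
Qed.

Lemma brownian_incr_mgf s t c : 0 <= s -> s < t ->
  (\int[P]_w (expR (c * (B t w - B s w)))%:E
   = (expR (c ^+ 2 * (t - s) / 2))%:E)%E.
Proof.
move=> s0 st; have t0 : 0 <= t by rewrite (le_trans s0)// ltW.
have ts : 0 < t - s by rewrite subr_gt0.
rewrite -normal_mgf//.
under eq_integral do rewrite -[X in X%:E]mul1r.
have := @eq_weighted_integral R _ _ _ _ P lebesgue_measure (cst 1)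
  (fun w => B t w - B s w) (normal_pdf 0 (Num.sqrt (t - s))) id
  (fun x => expR (c * x)).
apply => //.
- exact: brownian_measurable_incr.
- exact: measurable_normal_pdf.
- by move=> x; exact: normal_pdf_ge0.
- move=> A mA; case: hB => _ _ _ /(_ s t s0 st A mA) + _.
  under eq_integral do rewrite mul1r.
  rewrite /normal_prob [X in _ = X]integral_mkcond => hA.
  transitivity (\int[P]_x (\1_((fun w => B t w - B s w) @^-1` A) x)%:E)%E.
    by [].
  rewrite integral_indic ?setIT//; last first.
    by rewrite -[X in measurable X]setTI; exact: brownian_measurable_incr.
  apply: (etrans hA); apply: eq_integral => x _.
  rewrite patchE indicE; case: ifPn => xA; rewrite ?mulr1 ?mulr0//.
- by apply: measurableT_comp => //; exact: measurable_funM.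
Qed.

Let D (t : nat -> R) i w := B (t i.+1) w - B (t i) w.

(** Brownian motion is given with a product rule for events; it is extended to functions one factor
    at a time. Finite integrals let the product of the remaining factors act as a real constant. *)
Lemma brownian_incr_prod (t : nat -> R) (g : nat -> R -> R) (n : nat) :
  0 <= t 0%N -> (forall n, t n <= t n.+1) ->
  (forall i, measurable_fun setT (g i)) -> (forall i x, 0 <= g i x) ->
  (forall i, \int[P]_w (g i (D t i w))%:E < +oo)%E ->
  (\int[P]_w (\prod_(i < n) g i (D t i w))%:E
   = \prod_(i < n) \int[P]_w (g i (D t i w))%:E)%E.
Proof.
move=> t00 tS.
have t0 i : 0 <= t i by elim: i => // i ih; exact: le_trans (tS i).
have int1 : (\int[P]_w 1 = 1)%E.
  by rewrite (integral_cst P measurableT 1%E) mul1e; exact: probability_setT.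
have mD i : measurable_fun setT (D t i) by exact: brownian_measurable_incr.
(* The factors with index below k are arbitrary, the other ones indicators. *)
suff H k : (k <= n)%N -> forall g : nat -> R -> R,
  (forall i, measurable_fun setT (g i)) -> (forall i x, 0 <= g i x) ->
  (forall i, \int[P]_w (g i (D t i w))%:E < +oo)%E ->
  (forall i, (k <= i)%N -> exists2 A, measurable A & g i = \1_A) ->
  (\int[P]_w (\prod_(i < n) g i (D t i w))%:E
   = \prod_(i < n) \int[P]_w (g i (D t i w))%:E)%E.
  move=> mg g0 gf.
  (* Beyond [n] the factors become 1, the indicator of [setT], as the case [k = n] of the claim
     requires. *)
  pose g' i := if (i < n)%N then g i else cst 1.
  have := H n (leqnn n) g'.
  under eq_integral => w _ do under eq_bigr => i _ do rewrite /g' ltn_ord.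
  under [in X in _ -> X]eq_bigr => i _ do rewrite -/(D _ _).
  move=> ->.
  - by apply: eq_bigr => i _; rewrite /g' ltn_ord.
  - by move=> i; rewrite /g'; case: ifP.
  - by move=> i x; rewrite /g'; case: ifP.
  - move=> i; rewrite /g'; case: ifP => // _.
    by rewrite int1 ltry.
  - move=> i; rewrite leqNgt /g' => /negbTE ->; exists setT => //.
    by apply/funext => x; rewrite indicT.
elim: k => [_ {}g mg g0 gf gA|k ih kn {}g mg g0 gf gA].
  have /choice[A hA] : forall i, exists A, measurable A /\ g i = \1_A.
    by move=> i; have [A mA ->] := gA i (leq0n i); exists A.
  have hgA i : g i = \1_(A i) by have [] := hA i.
  have mA i : measurable (A i) by have [] := hA i.
  case: hB => _ _ _ _ /(_ t t00 tS A n mA) hP.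
  have mDA i : measurable (D t i @^-1` A i).
    by rewrite -[X in measurable X]setTI; exact: mD.
  transitivity (P [set w | forall i, (i < n)%N -> A i (D t i w)]).
    rewrite -[X in P X]setIT -integral_indic//; last first.
      rewrite (_ : mkset _ = \bigcap_(i in [set i | (i < n)%N]) (D t i @^-1` A i)).
        by apply: bigcap_measurableType => k _; exact: mDA.
      by apply/seteqP; split => w /=.
    apply: eq_integral => w _; congr EFin; rewrite indicE.
    have [/set_mem/= wA|/negP wA] := boolP (w \in _).
      rewrite big1// => i _; rewrite hgA indicE mem_set//; exact: wA.
    apply/eqP/prodf_eq0.
    have : exists i, ~ ((i < n)%N -> A i (D t i w)).
      apply/existsNP => wA'; apply: wA; exact: mem_set.
    move=> [i /not_implyP[iln nA]]; exists (Ordinal iln) => //=.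
    by rewrite hgA indicE memNset.
  rewrite hP; apply: eq_bigr => i _.
  have := integral_indic P measurableT (mDA i); rewrite setIT => <-.
  by apply: eq_integral => w _; rewrite hgA.
have kn' : (k < n)%N by [].
pose W w := \prod_(i < n) (if i == k :> nat then 1 else g i (D t i w)).
have mW : measurable_fun setT W.
  apply: measurable_prod => i _.
  by case: eqP => // _; exact: measurableT_comp.
have W0 w : 0 <= W w by apply: prodr_ge0 => i _; case: ifP.
have Wg h w : \prod_(i < n) (if i == k :> nat then h else g i) (D t i w)
     = W w * h (D t k w).
  rewrite /W (bigD1 (Ordinal kn'))//= [in RHS](bigD1 (Ordinal kn'))//=.
  rewrite eqxx mul1r mulrC; congr (_ * _).
  by apply: eq_bigr => i; rewrite -val_eqE/= => /negbTE ->.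
pose C := (\prod_(i < n | i != k :> nat) \int[P]_w (g i (D t i w))%:E)%E.
have gfin h : (forall x, 0 <= h x) -> (\int[P]_w (h (D t k w))%:E < +oo)%E ->
    (\int[P]_w (h (D t k w))%:E \is a fin_num)%E.
  move=> h0 hf; rewrite ge0_fin_numE//.
  by apply: integral_ge0 => w _; rewrite lee_fin.
have Cfin : C \is a fin_num.
  apply: prode_fin_num => i _; rewrite ge0_fin_numE//.
  by apply: integral_ge0 => w _; rewrite lee_fin.
have C0 : (0 <= C)%E.
  by apply: prode_ge0 => i _; apply: integral_ge0 => w _; rewrite lee_fin.
(* With an indicator in place [k] the induction hypothesis applies. It says that the weights [W] and
   [fine C] agree on all events of [D t k], hence on [g k]. *)
have key A : measurable A ->
  (\int[P]_w (W w * \1_A (D t k w))%:E = C * \int[P]_w (\1_A (D t k w))%:E)%E.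
  move=> mA.
  under eq_integral do rewrite -Wg.
  have -> := ih (ltnW kn) (fun i => if i == k then \1_A else g i); last 4 first.
  - by move=> i; case: eqP => // _; exact: measurable_indic.
  - by move=> i x; case: eqP => // _; rewrite indicE.
  - move=> i; case: eqP => // _.
    apply: (@le_lt_trans _ _ (\int[P]_w 1)%E); last first.
      by rewrite int1 ltry.
    apply: ge0_le_integral => //.
    + by apply/measurable_EFinP/measurableT_comp => //; exact: measurable_indic.
    + by move=> w _; rewrite lee_fin indicE; case: (_ \in _).
  - move=> i ki; case: eqP => [_|/eqP ik]; first by exists A.
    by apply: gA; rewrite ltn_neqAle eq_sym ik.
  rewrite (bigD1 (Ordinal kn'))//= eqxx muleC; congr (_ * _)%E.
  apply: eq_big => [i|i]; first by rewrite -val_eqE.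
  by rewrite -val_eqE/= => /negbTE ->.
have fC0 : 0 <= fine C by rewrite fine_ge0.
transitivity (\int[P]_w (W w * g k (D t k w))%:E)%E.
  apply: eq_integral => w _; rewrite -Wg; congr EFin.
  by apply: eq_bigr => i _; case: eqP => // ->.
rewrite (@eq_weighted_integral _ _ _ _ _ P P W (D t k) (cst (fine C)) (D t k) (g k))//.
  under eq_integral do rewrite EFinM.
  rewrite ge0_integralZl_EFin//; last 2 first.
  - by move=> w _; rewrite lee_fin.
  - by apply/measurable_EFinP; exact: measurableT_comp.
  rewrite fineK// [in RHS](bigD1 (Ordinal kn'))//= muleC; congr (_ * _)%E.
move=> A mA; rewrite key//.
under [RHS]eq_integral do rewrite EFinM.
rewrite ge0_integralZl_EFin// ?fineK//.
- by apply/measurable_EFinP/measurableT_comp => //; exact: measurable_indic.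
Qed.

Lemma brownian_incr_mgf_prod (t : nat -> R) (c : nat -> R) (n : nat) :
  0 <= t 0%N -> (forall n, t n < t n.+1) ->
  (\int[P]_w (expR (\sum_(i < n) c i * (B (t i.+1) w - B (t i) w)))%:E
   = (expR (\sum_(i < n) c i ^+ 2 * (t i.+1 - t i) / 2))%:E)%E.
Proof.
move=> t0 tS; have t0' i : 0 <= t i.
  by elim: i => // i ih; exact/(le_trans ih)/ltW.
under eq_integral do rewrite expR_sum.
have := @brownian_incr_prod t (fun i x => expR (c i * x)) n t0.
move=> ->; last 4 first.
- by move=> i; exact: ltW.
- by move=> i; apply: measurableT_comp => //; exact: measurable_funM.
- by move=> i x; exact: expR_ge0.
- by move=> i; rewrite /D brownian_incr_mgf// ltry.
rewrite expR_sum -prodEFin; apply: eq_bigr => i _.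
by rewrite /D brownian_incr_mgf.
Qed.
End brownian_increments.

(** * Exponential moments of mean-square limits *)

Section truncated_exponential.
Context (R : realType).
Implicit Types (x y K : R).

(** Truncation at [K] caps the slope of the exponential at [K]: where the exponential is at most
    [K], so is its derivative. *)
Lemma min_expR_lipschitz K x y : 0 < K ->
  Num.min (expR x) K <= Num.min (expR y) K + K * `|x - y|.
Proof.
move=> K0; have aux z : y <= z -> z <= x -> expR z <= K ->
    expR z <= expR y + K * `|x - y|.
  move=> yz zx zK; rewrite ger0_norm ?subr_ge0 ?(le_trans yz)//.
  have eyz : expR y = expR (y - z) * expR z by rewrite -expRD subrK.
  have ez : 0 < expR z := expR_gt0 z.
  have h1 : (1 + (y - z)) * expR z <= expR y.
    by rewrite eyz ler_pM2r// expR_ge1Dx.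
  have h2 : expR z * (z - y) <= K * (x - y).
    by apply: ler_pM; rewrite ?subr_ge0 ?lerD2r// ltW.
  lra.
have N0 : 0 <= K * `|x - y| by rewrite mulr_ge0// ltW.
have [Ky|yK] := leP K (expR y).
  by rewrite (@le_trans _ _ K)// ?ge_min ?lexx ?orbT// lerDl.
have [xy|yx] := leP x y.
  rewrite (@le_trans _ _ (expR x))// ?ge_min ?lexx//.
  by rewrite ler_wpDr// ler_expR.
have [xK|Kx] := leP (expR x) K.
  by apply: aux => //; exact: ltW.
rewrite -[X in X <= _](lnK K0); apply: aux.
- by rewrite -ler_expR lnK// ltW.
- by rewrite -ler_expR lnK// ltW.
- by rewrite lnK.
Qed.

(** Young's inequality trades the distance for its square, the only quantity controlled in mean, at
    the price of an arbitrarily small [e]. *)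
Lemma min_expR_le_sqr K x y e : 0 < K -> 0 < e ->
  Num.min (expR x) K <= Num.min (expR y) K + (e + K ^+ 2 / e * (x - y) ^+ 2).
Proof.
move=> K0 e0; apply: (le_trans (min_expR_lipschitz x y K0)).
rewrite lerD2l -[(x - y) ^+ 2]real_normK ?num_real//.
set u := `|_|; have u0 : 0 <= u by rewrite /u.
have -> : K ^+ 2 / e * u ^+ 2 = (K * u) ^+ 2 / e by field; lra.
set v := K * u.
have v0 : 0 <= v by rewrite mulr_ge0// ltW.
rewrite -(ler_pM2r e0) mulrDl divfK ?gt_eqF//; nra.
Qed.

(** Above the level, [expR x] is less than its square divided by [K], so second exponential moments
    bound the loss due to truncation. *)
Lemma expR_le_min K x : 0 < K ->
  expR x <= Num.min (expR x) K + expR (2 * x) / K.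
Proof.
move=> K0; have -> : expR (2 * x) = expR x ^+ 2 by rewrite expRM_natl.
have e0 := expR_gt0 x; set u := expR x in e0 *.
have [uK|Ku] := leP u K; first by rewrite lerDl divr_ge0 ?sqr_ge0 ?(ltW K0).
rewrite -(ler_pM2r K0) mulrDl divfK ?gt_eqF//; nra.
Qed.

End truncated_exponential.

Section mgf_limit.
Context (d : measure_display) (T : measurableType d) (R : realType)
  (P : probability T R).

Lemma integral_prob_cst (r : R) : (\int[P]_w r%:E = r%:E)%E.
Proof.
by rewrite (integral_cst P measurableT r%:E) -[RHS]mule1; congr (_ * _)%E;
  exact: probability_setT.
Qed.

Variables (S : nat -> T -> R) (G : T -> R) (C M : R) (M_ : nat -> R).
Hypothesis mS : forall n, measurable_fun setT (S n).
Hypothesis mG : measurable_fun setT G.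
Hypothesis SG : (\int[P]_w ((S n w - G w) ^+ 2)%:E)%E @[n --> \oo] --> 0%E.
Hypothesis S2 : forall n, (\int[P]_w (expR (2 * S n w))%:E <= C%:E)%E.
Hypothesis SM : forall n, (\int[P]_w (expR (S n w))%:E = (M_ n)%:E)%E.
Hypothesis MM : M_ n @[n --> \oo] --> M.

Let mexp (g : T -> R) : measurable_fun setT g -> measurable_fun [set: T] (fun w => expR (g w)).
Proof. by move=> mg; exact: measurableT_comp. Qed.

Let mmin (g : T -> R) (K : R) : measurable_fun [set: T] g ->
  measurable_fun [set: T] (fun w => Num.min (expR (g w)) K).
Proof. by move=> mg; apply: measurable_minr => //; exact: mexp. Qed.

Let msqr n : measurable_fun [set: T] (fun w => (S n w - G w) ^+ 2).
Proof. by apply: measurable_funX; exact: measurable_funB. Qed.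

Let I n := (\int[P]_w ((S n w - G w) ^+ 2)%:E)%E.

Let I_eq n : (\int[P]_w ((G w - S n w) ^+ 2)%:E)%E = I n.
Proof. by apply: eq_integral => w _; rewrite -sqrrN opprB. Qed.

Let bound (f g h : T -> R) (e c : R) :
  measurable_fun [set: T] f -> measurable_fun [set: T] g ->
  measurable_fun [set: T] h ->
  (forall w, 0 <= f w) -> (forall w, 0 <= g w) -> (forall w, 0 <= h w) ->
  0 <= e -> 0 <= c -> (forall w, f w <= g w + (e + c * h w)) ->
  (\int[P]_w (f w)%:E <=
    \int[P]_w (g w)%:E + (e%:E + c%:E * \int[P]_w (h w)%:E))%E.
Proof.
move=> mf mg mh f0 g0 h0 e0 c0 fgh.
rewrite -ge0_integralZl_EFin//; last 2 first.
- by move=> w _; rewrite lee_fin.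
- exact/measurable_EFinP.
have mch : measurable_fun [set: T] (fun w => c * h w) by exact: measurable_funM.
rewrite -[e%:E]integral_prob_cst -ge0_integralD//; last 2 first.
- by move=> w _; rewrite -EFinM lee_fin mulr_ge0.
- by under eq_fun do rewrite -EFinM; exact/measurable_EFinP.
under [X in (_ <= _ + X)%E]eq_integral do rewrite -EFinM -EFinD.
rewrite -ge0_integralD//; last 4 first.
- by move=> w _; rewrite lee_fin.
- exact/measurable_EFinP.
- by move=> w _; rewrite lee_fin addr_ge0// mulr_ge0.
- by apply/measurable_EFinP; exact: measurable_funD.
apply: ge0_le_integral => //.
- by move=> w _; rewrite lee_fin.
- exact/measurable_EFinP.
- under eq_fun do rewrite -EFinD.
  by apply/measurable_EFinP; apply: measurable_funD => //; exact: measurable_funD.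
- by move=> w _; rewrite -EFinD lee_fin.
Qed.

Let rhs_cvg (a_ : nat -> R) (a e c : R) : a_ n @[n --> \oo] --> a ->
  ((a_ n)%:E + (e%:E + c%:E * I n))%E @[n --> \oo] --> (a%:E + e%:E)%E.
Proof.
move=> cva; rewrite -[e%:E in X in _ --> X]adde0 -(mule0 c%:E).
apply: cvgeD; first by rewrite mule0.
  by apply: cvg_EFin => //; exact: nearW.
apply: cvgeD => //; first exact: cvg_cst.
by apply: cvgeZl.
Qed.

(** At a fixed level the truncated moment of [G] exceeds that of [S n] by at most [e] in the limit;
    raising the level is monotone convergence. *)
Lemma mgf_limit_le : (\int[P]_w (expR (G w))%:E <= M%:E)%E.
Proof.
have trunc K : 0 < K -> (\int[P]_w (Num.min (expR (G w)) K)%:E <= M%:E)%E.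
  move=> K0; apply/lee_addgt0Pr => e e0.
  have cv := @rhs_cvg _ _ e (K ^+ 2 / e) MM; rewrite -(cvg_lim _ cv)//.
  apply: lime_ge; first by apply: cvgP; exact: cv.
  apply: nearW => n; rewrite -I_eq.
  have mGS : measurable_fun [set: T] (fun w => (G w - S n w) ^+ 2).
    by apply: measurable_funX; exact: measurable_funB.
  have := @bound (fun w => Num.min (expR (G w)) K)
    (fun w => Num.min (expR (S n w)) K) (fun w => (G w - S n w) ^+ 2)
    e (K ^+ 2 / e) (mmin _ mG) (mmin _ (mS n)) mGS.
  move=> b; apply: (le_trans (b _ _ _ _ _ _)).
  - by move=> w; rewrite le_min expR_ge0 ltW.
  - by move=> w; rewrite le_min expR_ge0 ltW.
  - by move=> w; exact: sqr_ge0.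
  - exact: ltW.
  - by rewrite divr_ge0 ?sqr_ge0// ltW.
  - by move=> w; exact: min_expR_le_sqr.
  rewrite leeD2r// -SM; apply: ge0_le_integral => //.
  - by move=> w _; rewrite lee_fin le_min expR_ge0 ltW.
  - by apply/measurable_EFinP; exact: mmin.
  - by apply/measurable_EFinP; exact: mexp.
  - by move=> w _; rewrite lee_fin ge_min lexx.
have h : (\int[P]_w (Num.min (expR (G w)) n.+1%:R)%:E)%E @[n --> \oo] -->
    (\int[P]_w (expR (G w))%:E)%E.
  have -> : (\int[P]_w (expR (G w))%:E =
      \int[P]_w limn (fun n => (Num.min (expR (G w)) n.+1%:R)%:E))%E.
    apply: eq_integral => w _; apply/esym/cvg_lim => //.
    apply: cvg_near_cst; exists (Num.truncn (expR (G w))).+1 => // n /= hn.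
    rewrite min_l//; have /andP[_] := truncn_itv (expR_ge0 (G w)).
    move=> /ltW/le_trans; apply; rewrite ler_nat; exact: leqW.
  apply: cvg_monotone_convergence => //.
  - by move=> n; apply/measurable_EFinP; exact: mmin.
  - by move=> w _ /= m n mn; rewrite lee_fin le_min !ge_min lexx /= ler_nat ltnS mn orbT.
rewrite -(cvg_lim _ h)//; apply: lime_le; first exact: cvgP h.
by apply: nearW => n; exact: trunc.
Qed.

Lemma mgf_limit_ge : (M%:E <= \int[P]_w (expR (G w))%:E)%E.
Proof.
have C0 : 0 <= C.
  rewrite -lee_fin; apply: le_trans (S2 0).
  by apply: integral_ge0 => w _; rewrite lee_fin expR_ge0.
apply/lee_addgt0Pr => e0 e00.
(* Truncating at [1 / e] loses at most [e * C], and Young's inequality loses [e]; together they make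
   [e0]. *)
pose e := e0 / (1 + C).
have e_gt0 : 0 < e by rewrite divr_gt0// ltr_wpDr.
have -> : e0 = e * C + e by rewrite /e; field; lra.
pose K := e^-1; have K0 : 0 < K by rewrite invr_gt0.
have [] := eqVneq (\int[P]_w (expR (G w))%:E)%E +oo%E.
  by move=> ->; rewrite addye// leey.
move=> Gfin.
have Gf : (\int[P]_w (expR (G w))%:E)%E \is a fin_num.
  rewrite ge0_fin_numE ?ltey//.
  by apply: integral_ge0 => w _; rewrite lee_fin expR_ge0.
rewrite -(fineK Gf) -EFinD addrA EFinD.
set E := fine _.
have cv : (M_ n)%:E @[n --> \oo] --> M%:E.
  by apply: cvg_EFin => //; exact: nearW.
have cvE : ((E + e * C)%:E + (e%:E + (K ^+ 2 / e)%:E * I n))%E @[n --> \oo]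
    --> ((E + e * C)%:E + e%:E)%E.
  by apply: (@rhs_cvg (fun=> E + e * C)); exact: cvg_cst.
rewrite -(cvg_lim _ cv)// -(cvg_lim _ cvE)//.
apply: lee_lim; [exact: cvgP cv|exact: cvgP cvE|apply: nearW => n].
rewrite -SM EFinD.
have b1 : (\int[P]_w (expR (S n w))%:E <=
    \int[P]_w (Num.min (expR (S n w)) K)%:E + (e * C)%:E)%E.
  have := @bound (fun w => expR (S n w)) (fun w => Num.min (expR (S n w)) K)
    (fun w => expR (2 * S n w)) 0 e (mexp (mS n)) (mmin _ (mS n)) _.
  rewrite add0e => b; apply: (le_trans (b _ _ _ _ _ _ _)) => //.
  - by apply: mexp; exact: measurable_funM.
  - by move=> w; rewrite le_min expR_ge0 ltW.
  - exact: ltW.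
  - move=> w; rewrite add0r -[e]invrK mulrC; exact: expR_le_min.
  - by rewrite leeD2l// [in leRHS]EFinM lee_wpmul2l// lee_fin ltW.
have b2 : (\int[P]_w (Num.min (expR (S n w)) K)%:E <=
    E%:E + (e%:E + (K ^+ 2 / e)%:E * I n))%E.
  have := @bound (fun w => Num.min (expR (S n w)) K)
    (fun w => Num.min (expR (G w)) K) (fun w => (S n w - G w) ^+ 2)
    e (K ^+ 2 / e) (mmin _ (mS n)) (mmin _ mG) (msqr n).
  move=> b; apply: (le_trans (b _ _ _ _ _ _)).
  - by move=> w; rewrite le_min expR_ge0 ltW.
  - by move=> w; rewrite le_min expR_ge0 ltW.
  - by move=> w; exact: sqr_ge0.
  - exact: ltW.
  - by rewrite divr_ge0 ?sqr_ge0// ltW.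
  - by move=> w; exact: min_expR_le_sqr.
  rewrite leeD2r// fineK//; apply: ge0_le_integral => //.
  - by move=> w _; rewrite lee_fin le_min expR_ge0 ltW.
  - by apply/measurable_EFinP; exact: mmin.
  - by apply/measurable_EFinP; exact: mexp.
  - by move=> w _; rewrite lee_fin ge_min lexx.
apply: (le_trans b1); apply: (le_trans (leeD2r _ b2)).
by rewrite addeAC.
Qed.

Lemma mgf_limit : (\int[P]_w (expR (G w))%:E = M%:E)%E.
Proof. by apply/eqP; rewrite eq_le mgf_limit_le mgf_limit_ge. Qed.

End mgf_limit.

(** * Riemann step approximations of sigma *)

Section riemann.
Context (R : realType) (sigma : R -> R).
Hypothesis hsigma : {within `[0, +oo[, continuous sigma}.
Hypothesis hsigma_decr :
  forall s t, 0 <= s -> s <= t -> sigma t ^+ 2 <= sigma s ^+ 2.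

Definition left_steps (dl : R) (n : nat) : seq (R * R * R) :=
  [seq (sigma (i%:R * dl), i%:R * dl, i.+1%:R * dl) | i <- iota 0 n].

Lemma left_steps_on dl n : 0 <= dl -> step_on (n%:R * dl) (left_steps dl n).
Proof.
move=> dl0; apply/allP => p /mapP[i]; rewrite mem_iota /= add0n => ni ->/=.
by rewrite mulr_ge0// !ler_wpM2r// ler_nat.
Qed.

Lemma step_fun_left_steps dl n s :
  step_fun (left_steps dl n) s =
  \sum_(i < n) sigma (i%:R * dl) * \1_(`]i%:R * dl, i.+1%:R * dl]) s.
Proof. by rewrite /step_fun big_map -[n in iota 0 n]subn0 big_mkord. Qed.

Lemma step_integral_left_steps (T : Type) (B : R -> T -> R) dl n w :
  \sum_(p <- left_steps dl n) p.1.1 * (B p.2 w - B p.1.2 w) =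
  \sum_(i < n) sigma (i%:R * dl) * (B (i.+1%:R * dl) w - B (i%:R * dl) w).
Proof. by rewrite big_map -[n in iota 0 n]subn0 big_mkord. Qed.

Lemma grid_cell (dl : R) n s : 0 < s -> s <= n%:R * dl ->
  exists2 i, (i < n)%N & i%:R * dl < s <= i.+1%:R * dl.
Proof.
elim: n => [|n ih] s0; first by rewrite mul0r leNgt s0.
move=> sn; have [/(ih s0)[i ni hi]|ns] := leP s (n%:R * dl).
  by exists i => //; exact: ltnW.
by exists n => //; rewrite ns.
Qed.

Lemma step_fun_cell (dl : R) n i s : 0 < dl -> (i < n)%N ->
  i%:R * dl < s <= i.+1%:R * dl ->
  step_fun (left_steps dl n) s = sigma (i%:R * dl).
Proof.
move=> dl0 ni /andP[is1 is2]; rewrite step_fun_left_steps.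
rewrite (bigD1 (Ordinal ni))//= big1 ?addr0.
  by rewrite indicE mem_set ?mulr1//= in_itv/= is1 is2.
move=> j /eqP ji; rewrite indicE memNset ?mulr0//= in_itv/= => /andP[js1 js2].
apply: ji; apply/val_inj => /=.
have := lt_le_trans is1 js2; rewrite ltr_pM2r// ltr_nat.
have := lt_le_trans js1 is2; rewrite ltr_pM2r// ltr_nat.
by lia.
Qed.

Lemma normr_sigma_le (s : R) : 0 <= s -> `|sigma s| <= `|sigma 0|.
Proof.
move=> s0; rewrite -(@ler_pXn2r _ 2) ?nnegrE// !real_normK ?num_real//.
exact: hsigma_decr.
Qed.

Lemma dyadic_grid (h : R) (l p : nat) :
  (l * 2 ^ p)%:R * (h / 2 ^+ p) = l%:R * h.
Proof. by rewrite natrM natrX mulrACA mulfV ?mulr1// gt_eqF// exprn_gt0. Qed.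

Lemma left_steps_cvg (h : R) (l : nat) (s : R) : 0 < h -> 0 < s ->
  s <= l%:R * h ->
  step_fun (left_steps (h / 2 ^+ p) (l * 2 ^ p)) s @[p --> \oo] --> sigma s.
Proof.
move=> h0 s0 sl.
have cs : {for s, continuous sigma}.
  have /continuous_within_itvcyP[+ _] := hsigma.
  by apply; rewrite in_itv/= s0.
apply/cvgrPdist_lt => e e0.
have /cvgrPdist_lt/(_ e e0) := cs; rewrite near_simpl => /nbhs_ballP[r /= r0 hr].
have dp : h / 2 ^+ p @[p --> \oo] --> (0 : R).
  under eq_fun do rewrite -exprVn.
  by apply: cvg_geometric; rewrite ger0_norm ?invr_ge0// invf_lt1// ltr1n.
have /cvgrPdist_lt/(_ r r0) [N _ hN] := dp.
exists N => // p /hN /=; rewrite sub0r normrN => hp.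
have dl0 : 0 < h / 2 ^+ p by rewrite divr_gt0// exprn_gt0.
have sl' : s <= (l * 2 ^ p)%:R * (h / 2 ^+ p).
  by rewrite dyadic_grid.
have [i il /[dup] hi /andP[is1 is2]] := grid_cell s0 sl'.
rewrite (step_fun_cell dl0 il hi); apply: hr => /=.
rewrite /ball/= ger0_norm ?subr_ge0 1?ltW//.
rewrite (le_lt_trans _ hp)// (ger0_norm (ltW dl0)).
by rewrite lerBlDl; move: is2; rewrite -natr1 mulrDl mul1r.
Qed.

Lemma left_steps_approx (h : R) (l : nat) : 0 < h ->
  step_approx sigma (l%:R * h) (fun p => left_steps (h / 2 ^+ p) (l * 2 ^ p)).
Proof.
move=> h0.
have dl0 p : 0 < h / 2 ^+ p by rewrite divr_gt0// exprn_gt0.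
have gridE p := dyadic_grid h l p.
split=> [p|]; first by rewrite -(gridE p) left_steps_on// ltW.
have mD : measurable (`]0, l%:R * h] : set R) by exact: measurable_itv.
have msigma : measurable_fun (`]0, l%:R * h] : set R) sigma.
  apply: (@measurable_funS _ _ _ _ (`[0, +oo[%classic : set R)).
  - exact: measurable_itv.
  - by move=> x /=; rewrite !in_itv/= andbT => /andP[/ltW].
  - by apply: subspace_continuous_measurable_fun => //; exact: measurable_itv.
have mstep p : measurable_fun [set: R]
    (step_fun (left_steps (h / 2 ^+ p) (l * 2 ^ p))).
  rewrite (_ : step_fun _ = (fun s => \sum_(i < l * 2 ^ p) sigma (i%:R * (h / 2 ^+ p)) *
    \1_(`]i%:R * (h / 2 ^+ p), i.+1%:R * (h / 2 ^+ p)]) s)); last first.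
    by apply/funext => s; exact: step_fun_left_steps.
  by apply: measurable_sum => i; exact: measurable_funM.
have mdiff p : measurable_fun (`]0, l%:R * h] : set R)
    (fun s => ((step_fun (left_steps (h / 2 ^+ p) (l * 2 ^ p)) s - sigma s) ^+ 2)%:E).
  apply/measurable_EFinP; apply: measurable_funX; apply: measurable_funB => //.
  exact: measurable_funTS.
(* The step functions vanish at 0, where pointwise convergence may therefore fail; leaving out this
   point does not change the integral. *)
under eq_fun => p do rewrite -integral_itv_obnd_cbnd//.
have Dfin : (lebesgue_measure (`]0%R, (l%:R * h)%R] : set R) < +oo)%E.
  by rewrite lebesgue_measure_itv/=; case: ifP => _; rewrite -?EFinB ltry.
have cstint : lebesgue_measure.-integrable (`]0, l%:R * h] : set R)
    (fun=> ((`|sigma 0| + `|sigma 0|) ^+ 2)%:E).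
  apply: (@measurable_bounded_integrable _ _ R lebesgue_measure
    (fun=> (`|sigma 0| + `|sigma 0|) ^+ 2)) => //.
  exact: bounded_cst.
have := @dominated_convergence _ _ R lebesgue_measure _ mD
 (fun p s => ((step_fun (left_steps (h / 2 ^+ p) (l * 2 ^ p)) s - sigma s) ^+ 2)%:E)
 (cst 0%E) _ mdiff (measurable_cst _) _ cstint.
case.
- apply: aeW => s /=; rewrite in_itv/= => /andP[s0 sl].
  apply: cvg_EFin; first exact: nearW.
  have cvd : step_fun (left_steps (h / 2 ^+ p) (l * 2 ^ p)) s - sigma s
      @[p --> \oo] --> (0 : R).
    rewrite -(subrr (sigma s)).
    by apply: cvgB; [exact: left_steps_cvg|exact: cvg_cst].
  have cvd2 := cvgM cvd cvd; rewrite mulr0 in cvd2.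
  rewrite (_ : fine \o _ = (fun p => step_fun (left_steps (h / 2 ^+ p)
    (l * 2 ^ p)) s - sigma s) \* (fun p => step_fun (left_steps (h / 2 ^+ p)
    (l * 2 ^ p)) s - sigma s))//.
  exact: cvd2.
- apply: aeW => s p /=; rewrite in_itv/= => /andP[s0 sl].
  rewrite lee_fin normrX.
  have sl' : s <= (l * 2 ^ p)%:R * (h / 2 ^+ p) by rewrite gridE.
  have [i il hi] := grid_cell s0 sl'.
  rewrite (step_fun_cell (dl0 p) il hi) ler_pXn2r ?nnegrE ?addr_ge0//.
  apply: (le_trans (ler_normB _ _)); apply: lerD; apply: normr_sigma_le.
    by rewrite mulr_ge0// ltW.
  exact: ltW.
- move=> _ _; rewrite integral0; exact.
Qed.


(** The variance of the step integral over the [l]-th cell of mesh [h]. Sampling at left ends makes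
    it an upper Riemann sum of [sigma ^+ 2]. *)
Definition dyadic_var (h : R) (l p : nat) : R :=
  \sum_(k < 2 ^ p) sigma ((l * 2 ^ p + k)%:R * (h / 2 ^+ p)) ^+ 2 * (h / 2 ^+ p).

Lemma sum_dyadic_cst (x h : R) (p : nat) :
  \sum_(k < 2 ^ p) x * (h / 2 ^+ p) = x * h.
Proof.
have := dyadic_grid h 1 p; rewrite mul1n mul1r => {2}<-.
by rewrite sumr_const card_ord [RHS]mulrCA [RHS]mulr_natl.
Qed.

Lemma dyadic_var_le h l p : 0 < h ->
  dyadic_var h l p <= sigma (l%:R * h) ^+ 2 * h.
Proof.
move=> h0; have dl0 : 0 < h / 2 ^+ p by rewrite divr_gt0// exprn_gt0.
apply: (@le_trans _ _ (\sum_(k < 2 ^ p) sigma (l%:R * h) ^+ 2 * (h / 2 ^+ p))).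
  apply: ler_sum => k _; rewrite ler_pM2r//; apply: hsigma_decr.
    by rewrite mulr_ge0// ltW.
  by rewrite natrD mulrDl dyadic_grid lerDl mulr_ge0// ltW.
by rewrite sum_dyadic_cst.
Qed.

Lemma dyadic_var_ge h l p : 0 < h ->
  sigma (l.+1%:R * h) ^+ 2 * h <= dyadic_var h l p.
Proof.
move=> h0; have dl0 : 0 < h / 2 ^+ p by rewrite divr_gt0// exprn_gt0.
apply: (@le_trans _ _ (\sum_(k < 2 ^ p) sigma (l.+1%:R * h) ^+ 2 * (h / 2 ^+ p))).
  by rewrite sum_dyadic_cst.
apply: ler_sum => k _; rewrite ler_pM2r//; apply: hsigma_decr.
  by rewrite mulr_ge0// ltW.
have -> : l.+1%:R * h = (l * 2 ^ p + 2 ^ p)%:R * (h / 2 ^+ p).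
  by rewrite -mulSnr dyadic_grid.
by rewrite ler_pM2r// ler_nat leq_add2l ltnW.
Qed.

Lemma sum_nat_blocks (V : nmodType) (F : nat -> V) n m :
  \sum_(i < n * m) F i = \sum_(l < n) \sum_(k < m) F (l * m + k)%N.
Proof.
elim: n => [|n ih]; first by rewrite mul0n !big_ord0.
rewrite big_ord_recr/= -ih mulSnr big_split_ord/=.
by congr (_ + _); apply: eq_bigr.
Qed.

(** Refinement halves each cell and replaces the value on its right half by a smaller one. *)
Lemma dyadic_var_decr h l : 0 < h -> nonincreasing_seq (dyadic_var h l).
Proof.
move=> h0; apply/nonincreasing_seqP => p; rewrite /dyadic_var.
rewrite [X in (X <= _)%O](_ : _ = \sum_(k < 2 ^ p * 2)
    (sigma ((l * 2 ^ p.+1 + k)%:R * (h / 2 ^+ p.+1)) ^+ 2 * (h / 2 ^+ p.+1))); last first.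
  by rewrite expnSr.
rewrite (sum_nat_blocks (fun k =>
  sigma ((l * 2 ^ p.+1 + k)%:R * (h / 2 ^+ p.+1)) ^+ 2 * (h / 2 ^+ p.+1))).
apply: ler_sum => k _; rewrite big_ord_recl big_ord1/=.
set dl := h / 2 ^+ p.+1.
have dl0 : 0 < dl by rewrite divr_gt0// exprn_gt0.
have -> : h / 2 ^+ p = 2 * dl.
  by rewrite /dl exprS invfM; field; rewrite gt_eqF// exprn_gt0.
have -> : (l * 2 ^ p + k)%:R * (2 * dl) = (l * 2 ^ p.+1 + (k * 2 + 0))%:R * dl.
  by rewrite mulrA -(natrM _ _ 2); congr (_%:R * _); rewrite expnS; lia.
rewrite [leRHS]mulrCA [leRHS]mulr_natl [leRHS]mulr2n lerD2l ler_pM2r//.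
apply: hsigma_decr; first by rewrite mulr_ge0// ltW.
by rewrite ler_pM2r// ler_nat; lia.
Qed.

End riemann.

(** * Exponential moments of the stochastic integral *)

Section stochastic_integral_mgf.
Context (R : realType) (d : measure_display) (T : measurableType d)
  (P : probability T R) (F : R -> set (set T)) (B J : R -> T -> R)
  (sigma : R -> R).
Hypothesis hF : complete_filtration P F.
Hypothesis hB : brownian_motion P B.
Hypothesis hsigma : {within `[0, +oo[, continuous sigma}.
Hypothesis hsigma_decr :
  forall s t, 0 <= s -> s <= t -> sigma t ^+ 2 <= sigma s ^+ 2.
Hypothesis hJ : stochastic_integral P F B sigma J.

Lemma adapted_measurable X t : adapted F X -> 0 <= t -> measurable_fun setT (X t).
Proof.
case: hF => _ Fm _ _ aX t0 _ A mA; rewrite setTI; apply: (Fm t) => //.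
exact: aX.
Qed.

Lemma L2_cvg0_lin (U V : nat -> T -> R) (c : R) :
  (forall n, measurable_fun setT (U n)) -> (forall n, measurable_fun setT (V n)) ->
  (\int[P]_w (U n w ^+ 2)%:E)%E @[n --> \oo] --> 0%E ->
  (\int[P]_w (V n w ^+ 2)%:E)%E @[n --> \oo] --> 0%E ->
  (\int[P]_w ((U n w + c * V n w) ^+ 2)%:E)%E @[n --> \oo] --> 0%E.
Proof.
move=> mU mV cU cV.
have mU2 n : measurable_fun [set: T] (fun w => (U n w ^+ 2)%:E).
  by apply/measurable_EFinP; exact: measurable_funX.
have mV2 n : measurable_fun [set: T] (fun w => (V n w ^+ 2)%:E).
  by apply/measurable_EFinP; exact: measurable_funX.
have cUV : (2%:E * (\int[P]_w (U n w ^+ 2)%:E) +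
    (2 * c ^+ 2)%:E * (\int[P]_w (V n w ^+ 2)%:E))%E @[n --> \oo] --> 0%E.
  rewrite -(adde0 0%E) -[X in (X + _)%E](mule0 2%:E) -[X in (_ + X)%E](mule0 (2 * c ^+ 2)%:E).
  by apply: cvgeD; [rewrite !mule0|apply: cvgeZl|apply: cvgeZl].
apply: (squeeze_cvge _ (cvg_cst 0%E) cUV).
apply: nearW => n; apply/andP; split.
  by apply: integral_ge0 => w _; rewrite lee_fin sqr_ge0.
have c20 : 0 <= 2 * c ^+ 2 by rewrite mulr_ge0// sqr_ge0.
rewrite -ge0_integralZl_EFin//; last by move=> w _; rewrite lee_fin sqr_ge0.
rewrite -ge0_integralZl_EFin//; last by move=> w _; rewrite lee_fin sqr_ge0.
rewrite -ge0_integralD//; first last.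
- exact: measurable_funeM.
- by move=> w _; rewrite -EFinM lee_fin mulr_ge0// sqr_ge0.
- exact: measurable_funeM.
- by move=> w _; rewrite -EFinM lee_fin mulr_ge0// sqr_ge0.
apply: ge0_le_integral => //.
- by move=> w _; rewrite lee_fin sqr_ge0.
- apply/measurable_EFinP; apply: measurable_funX; apply: measurable_funD => //.
  exact: measurable_funM.
- by apply: emeasurable_funD; exact: measurable_funeM.
- move=> w _; rewrite -!EFinM -EFinD lee_fin.
  have := sqr_ge0 (U n w - c * V n w); nra.
Qed.

(** Here [v l] is the integral of [sigma ^+ 2] over a cell, obtained as a limit of upper sums. The
    identity for all coefficients says that the increments are independent centred Gaussian
    variables with variances [v l]. It serves both for unit cells and for cells of length 2^-m. *)
Lemma stochastic_integral_mgf (h : R) : 0 < h -> exists v : nat -> R,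
  (forall l, sigma (l.+1%:R * h) ^+ 2 * h <= v l <= sigma (l%:R * h) ^+ 2 * h) /\
  forall (a : nat -> R) (L : nat),
    (\int[P]_w (expR (\sum_(l < L) a l * (J (l.+1%:R * h) w - J (l%:R * h) w)))%:E
     = (expR (\sum_(l < L) a l ^+ 2 * v l / 2))%:E)%E.
Proof.
move=> h0; exists (fun l => limn (dyadic_var sigma h l)).
have vcvg l : dyadic_var sigma h l @ \oo --> limn (dyadic_var sigma h l).
  apply: nonincreasing_is_cvgn; first exact: dyadic_var_decr.
  exists 0 => _ [p _ <-]; apply: le_trans (dyadic_var_ge hsigma_decr l p h0).
  by rewrite mulr_ge0 ?sqr_ge0 ?ltW.
split=> [l|a L].
  apply/andP; split.
  - apply: limr_ge; first exact: vcvg.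
    by apply: nearW => p; exact: dyadic_var_ge.
  - apply: limr_le; first exact: vcvg.
    by apply: nearW => p; exact: dyadic_var_le.
case: hJ => aJ _ sJ.
have mB : forall t, 0 <= t -> measurable_fun setT (B t) by case: hB.
have mJ t : 0 <= t -> measurable_fun setT (J t) by exact: adapted_measurable.
have dl0 p : 0 < h / 2 ^+ p by rewrite divr_gt0// exprn_gt0.
pose I p l w := step_integral B (left_steps sigma (h / 2 ^+ p) (l * 2 ^ p)) w.
have IE p l w : I p l w = \sum_(i < l * 2 ^ p) sigma (i%:R * (h / 2 ^+ p)) *
    (B (i.+1%:R * (h / 2 ^+ p)) w - B (i%:R * (h / 2 ^+ p)) w).
  exact: step_integral_left_steps.
have mI p l : measurable_fun setT (I p l).
  rewrite (_ : I p l = fun w => \sum_(i < l * 2 ^ p) sigma (i%:R * (h / 2 ^+ p)) *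
    (B (i.+1%:R * (h / 2 ^+ p)) w - B (i%:R * (h / 2 ^+ p)) w)); last exact/funext.
  apply: measurable_sum => i; apply: measurable_funM => //.
  by apply: measurable_funB; apply: mB; rewrite mulr_ge0// ltW.
have cI l : (\int[P]_w ((I p l w - J (l%:R * h) w) ^+ 2)%:E)%E @[p --> \oo] --> 0%E.
  have lh0 : 0 <= l%:R * h by rewrite mulr_ge0// ltW.
  by have [_] := sJ _ lh0; apply; exact: left_steps_approx.
pose S p w := \sum_(l < L) a l * (I p l.+1 w - I p l w).
(* All times share the mesh [h / 2 ^+ p], so increments of step integrals are sums over disjoint
   blocks of cells, the cell [i] lying in the block [i %/ 2 ^ p]. *)
have SE p w : S p w = \sum_(i < L * 2 ^ p) a (i %/ 2 ^ p)%N * sigma (i%:R * (h / 2 ^+ p)) *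
    (B (i.+1%:R * (h / 2 ^+ p)) w - B (i%:R * (h / 2 ^+ p)) w).
  rewrite (sum_nat_blocks (fun i => a (i %/ 2 ^ p)%N * sigma (i%:R * (h / 2 ^+ p)) *
    (B (i.+1%:R * (h / 2 ^+ p)) w - B (i%:R * (h / 2 ^+ p)) w))).
  apply: eq_bigr => l _; rewrite !IE mulSnr big_split_ord/= addrAC subrr add0r.
  rewrite big_distrr/=; apply: eq_bigr => k _.
  by rewrite divnMDl ?expn_gt0// divn_small// addn0 mulrA.
(* The value [c = 1] gives the converging moments, [c = 2] the uniform bound on second exponential
   moments. *)
have mgfS c p : (\int[P]_w (expR (c * S p w))%:E =
    (expR (\sum_(l < L) (c * a l) ^+ 2 * dyadic_var sigma h l p / 2))%:E)%E.
  under eq_integral do rewrite SE big_distrr/=.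
  have := brownian_incr_mgf_prod hB (t := fun i => i%:R * (h / 2 ^+ p))
    (fun i => c * (a (i %/ 2 ^ p)%N * sigma (i%:R * (h / 2 ^+ p)))) (L * 2 ^ p).
  move=> /(_ _ _)/=; rewrite mul0r => /(_ (lexx _)) mgfB.
  under eq_integral do under eq_bigr do rewrite mulrA.
  rewrite mgfB; last by move=> n; rewrite ltr_pM2r// ltr_nat.
  congr (expR _)%:E.
  rewrite (sum_nat_blocks (fun i => (c * (a (i %/ 2 ^ p)%N * sigma (i%:R * (h / 2 ^+ p)))) ^+ 2 *
    (i.+1%:R * (h / 2 ^+ p) - i%:R * (h / 2 ^+ p)) / 2)).
  apply: eq_bigr => l _; rewrite /dyadic_var big_distrr big_distrl/=.
  apply: eq_bigr => k _.
  rewrite divnMDl ?expn_gt0// divn_small// addn0 -[(l * 2 ^ p + k).+1%:R]natr1.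
  by set dl := h / _; set y := (l * _ + k)%:R; set x := sigma _; field.
pose G w := \sum_(l < L) a l * (J (l.+1%:R * h) w - J (l%:R * h) w).
have mG : measurable_fun [set: T] G.
  apply: measurable_sum => l; apply: measurable_funM => //.
  by apply: measurable_funB; apply: mJ; rewrite mulr_ge0// ltW.
have mS p : measurable_fun [set: T] (S p).
  apply: measurable_sum => l; apply: measurable_funM => //.
  exact: measurable_funB.
apply: (@mgf_limit _ _ _ _ S G
  (expR (\sum_(l < L) (2 * a l) ^+ 2 * (sigma (l%:R * h) ^+ 2 * h) / 2)) _
  (fun p => expR (\sum_(l < L) a l ^+ 2 * dyadic_var sigma h l p / 2))) => //.
- have mE p l : measurable_fun [set: T] (fun w => I p l w - J (l%:R * h) w).
    by apply: measurable_funB => //; apply: mJ; rewrite mulr_ge0// ltW.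
  have cE l : (\int[P]_w (((I p l.+1 w - J (l.+1%:R * h) w) +
      -1 * (I p l w - J (l%:R * h) w)) ^+ 2)%:E)%E @[p --> \oo] --> 0%E.
    by apply: L2_cvg0_lin.
  have mEE p l : measurable_fun [set: T] (fun w => (I p l.+1 w - J (l.+1%:R * h) w) +
      -1 * (I p l w - J (l%:R * h) w)).
    by apply: measurable_funD => //; exact: measurable_funM.
  have SG p w : S p w - G w = \sum_(l < L) a l * ((I p l.+1 w - J (l.+1%:R * h) w) +
      -1 * (I p l w - J (l%:R * h) w)).
    by rewrite /S /G -sumrB; apply: eq_bigr => l _; ring.
  under eq_fun do under eq_integral do rewrite SG.
  elim: (L) => [|L' ih].
    under eq_fun do under eq_integral do rewrite big_ord0 expr0n/=.
    by under eq_fun do rewrite integral0; exact: cvg_cst.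
  under eq_fun do under eq_integral do rewrite big_ord_recr/=.
  apply: L2_cvg0_lin => // p.
  by apply: measurable_sum => l; exact: measurable_funM.
- move=> p; rewrite mgfS lee_fin ler_expR; apply: ler_sum => l _.
  rewrite ler_pM2r ?invr_gt0// ler_wpM2l ?sqr_ge0//.
  exact: dyadic_var_le.
- by move=> p; have := mgfS 1 p; under eq_integral do rewrite mul1r;
    under [in X in _ -> X]eq_bigr do rewrite -[a _]mul1r.
- apply: (cvg_comp _ expR); last exact: continuous_expR.
  apply: cvg_big => [|l _]; first exact: add_continuous.
  apply: cvgM; last exact: cvg_cst.
  by apply: cvgM; [exact: cvg_cst|exact: vcvg].
Qed.

End stochastic_integral_mgf.

(** * A second moment method *)

Section second_moment.
Context (R : realType) (d : measure_display) (T : measurableType d)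
  (P : probability T R).
Variables (G : nat -> T -> R) (k : nat -> nat -> R) (a : nat -> R) (C : R).
Hypothesis mG : forall i, measurable_fun setT (G i).
Hypothesis G1 : forall i, (\int[P]_w (expR (G i w))%:E = (expR (k i i / 2))%:E)%E.
Hypothesis G2 : forall i j, (\int[P]_w (expR (G i w + G j w))%:E
  = (expR ((k i i + k j j) / 2 + k i j))%:E)%E.
Hypothesis a0 : forall i, 0 <= a i.
Let A N := \sum_(i < N) a i.
Hypothesis ak : forall N,
  \sum_(i < N) \sum_(j < N) a i * a j * expR (k i j) <= A N ^+ 2 + C * A N.
Hypothesis Aoo : forall x, exists N, x <= A N.

Let Z i w := expR (G i w - k i i / 2).

Let mZ i : measurable_fun [set: T] (Z i).
Proof. by apply: measurableT_comp => //; exact: measurable_funB. Qed.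

Let Z0 i w : 0 <= Z i w. Proof. exact: expR_ge0. Qed.

Let EZ i : (\int[P]_w (Z i w)%:E = 1)%E.
Proof.
under eq_integral do rewrite /Z expRD mulrC EFinM.
rewrite ge0_integralZl_EFin ?expR_ge0//; last first.
  by apply/measurable_EFinP; exact: measurableT_comp.
by rewrite G1 -EFinM -expRD addNr expR0.
Qed.

Let EZZ i j : (\int[P]_w (Z i w * Z j w)%:E = (expR (k i j))%:E)%E.
Proof.
under eq_integral do rewrite /Z -expRD addrACA expRD mulrC EFinM.
rewrite ge0_integralZl_EFin ?expR_ge0//; last first.
  apply/measurable_EFinP; apply: measurableT_comp => //.
  exact: measurable_funD.
by rewrite G2 -EFinM -expRD; congr (expR _)%:E; field.
Qed.

Let A0 N : 0 <= A N. Proof. exact: sumr_ge0. Qed.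

Let S N w := \sum_(i < N) a i * Z i w.

Let mS N : measurable_fun [set: T] (S N).
Proof. by apply: measurable_sum => i; exact: measurable_funM. Qed.

Let S0 N w : 0 <= S N w. Proof. by apply: sumr_ge0 => i _; rewrite mulr_ge0. Qed.

Let ES N : (\int[P]_w (S N w)%:E = (A N)%:E)%E.
Proof.
under eq_integral do rewrite /S -sumEFin.
rewrite ge0_integral_sum//.
- rewrite /A -sumEFin; apply: eq_bigr => i _.
  under eq_integral do rewrite EFinM.
  rewrite ge0_integralZl_EFin// ?EZ ?mule1//.
    by move=> w _; rewrite lee_fin.
  exact/measurable_EFinP.
- by move=> i; apply/measurable_EFinP; exact: measurable_funM.
- by move=> i w _; rewrite lee_fin mulr_ge0.
Qed.

Let ES2 N : (\int[P]_w (S N w ^+ 2)%:E <= (A N ^+ 2 + C * A N)%:E)%E.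
Proof.
have -> : (\int[P]_w (S N w ^+ 2)%:E =
    \int[P]_w \sum_(i < N) \sum_(j < N) (a i * a j * (Z i w * Z j w))%:E)%E.
  apply: eq_integral => w _; rewrite expr2 big_distrlr/= -sumEFin.
  apply: eq_bigr => i _; rewrite sumEFin; congr EFin.
  by apply: eq_bigr => j _; rewrite mulrACA.
have mZZ i j : measurable_fun [set: T] (fun w => Z i w * Z j w).
  exact: measurable_funM.
have maZZ i j : measurable_fun [set: T] (fun w => (a i * a j * (Z i w * Z j w))%:E).
  by apply/measurable_EFinP; exact: measurable_funM.
have aZZ0 i j w : (0 <= (a i * a j * (Z i w * Z j w))%:E)%E.
  by rewrite lee_fin !mulr_ge0.
rewrite ge0_integral_sum//; last 2 first.
- by move=> i; apply: emeasurable_sum.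
- by move=> i w _; apply: sume_ge0.
have akN := ak N; rewrite -lee_fin in akN; apply: le_trans akN.
rewrite -sumEFin; apply: lee_sum => i _.
rewrite ge0_integral_sum//.
rewrite -sumEFin; apply: lee_sum => j _.
under eq_integral do rewrite EFinM.
rewrite ge0_integralZl_EFin ?mulr_ge0//.
- by rewrite EZZ.
- by move=> w _; rewrite lee_fin mulr_ge0.
- exact/measurable_EFinP.
Qed.

Let ESA N : (\int[P]_w ((S N w - A N) ^+ 2)%:E <= (C * A N)%:E)%E.
Proof.
have mSA : measurable_fun [set: T] (fun w => (S N w - A N) ^+ 2).
  by apply: measurable_funX; exact: measurable_funB.
have E : (\int[P]_w ((S N w - A N) ^+ 2)%:E + (2 * A N ^+ 2)%:E =
    \int[P]_w (S N w ^+ 2)%:E + (A N ^+ 2)%:E)%E.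
  have -> : (2 * A N ^+ 2)%:E = (\int[P]_w (2 * A N * S N w)%:E)%E.
    under eq_integral do rewrite EFinM.
    rewrite ge0_integralZl_EFin ?mulr_ge0//; last 2 first.
    - by move=> w _; rewrite lee_fin.
    - exact/measurable_EFinP.
    by rewrite ES -EFinM -mulrA.
  rewrite -[X in (_ = _ + X)%E](integral_prob_cst P) -!ge0_integralD//.
  - by apply: eq_integral => w _; rewrite -!EFinD; congr EFin; ring.
  - by move=> w _; rewrite lee_fin sqr_ge0.
  - by apply/measurable_EFinP; exact: measurable_funX.
  - by move=> w _; rewrite lee_fin sqr_ge0.
  - by move=> w _; rewrite lee_fin sqr_ge0.
  - exact/measurable_EFinP.
  - by move=> w _; rewrite lee_fin !mulr_ge0.
  - by apply/measurable_EFinP; exact: measurable_funM.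
rewrite -(@leeD2rE _ (2 * A N ^+ 2)%:E)// E.
apply: le_trans (leeD2r _ (ES2 N)) _.
by rewrite -!EFinD lee_fin; lra.
Qed.

(** The variables [Z i] have mean one and the product [Z i * Z j] has mean [expR (k i j)], so by
    [ak] the weighted sum [S N] has mean [A N] and variance at most [C * A N]. If all [Z i] are at
    most 1/4, then [S N] is at least 3/4 of [A N] below its mean; by Chebyshev this has probability
    at most [C / (9 / 16 * A N)], which tends to 0. *)
Lemma second_moment_null : P.-negligible [set w | forall i, Z i w <= 1 / 4].
Proof.
pose E := \bigcap_i [set w | Z i w <= 1 / 4].
have mE : measurable E.
  apply: bigcapT_measurable => i.
  have -> : [set w | Z i w <= 1 / 4] = setT `&` Z i @^-1` `]-oo, 1 / 4].
    by rewrite setTI; apply/seteqP; split => w /=; rewrite in_itv.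
  by apply: mZ => //; exact: measurable_itv.
exists E; split=> //; last by move=> w /= h i _; exact: h.
have Pfin : P E \is a fin_num by exact: fin_num_measure.
have key N : fine (P E) * (9 / 16 * A N ^+ 2) <= C * A N.
  rewrite -lee_fin; apply: le_trans (ESA N).
  rewrite mulrC EFinM fineK// -[X in (_ * P X)%E]setIT -integral_indic//.
  have sA : 0 <= 9 / 16 * A N ^+ 2 by rewrite mulr_ge0// sqr_ge0.
  rewrite -ge0_integralZl_EFin//; last exact/measurable_EFinP.
  apply: ge0_le_integral => //.
  - by move=> w _; rewrite -EFinM lee_fin mulr_ge0.
  - by apply: measurable_funeM; exact/measurable_EFinP.
  - apply/measurable_EFinP; apply: measurable_funX; exact: measurable_funB.
  - move=> w _; rewrite -EFinM lee_fin indicE.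
    have [/set_mem Ew|_] := boolP (w \in E); last by rewrite mulr0 sqr_ge0.
    rewrite mulr1; have SA : S N w <= A N / 4.
      rewrite /S /A big_distrl/=; apply: ler_sum => i _.
      by have := Ew i I; rewrite /= mul1r => h; rewrite ler_wpM2l.
    have := A0 N; have := S0 N w; nra.
have p0 : 0 <= fine (P E) by rewrite fine_ge0.
rewrite -(fineK Pfin); apply/eqP; rewrite eqe eq_le p0 andbT leNgt.
apply/negP => p_gt0.
have [N hN] := Aoo ((`|C| + 1) / (fine (P E) * (9 / 16))).
have C1 : 0 < (`|C| + 1) / (fine (P E) * (9 / 16)).
  by rewrite divr_gt0 ?mulr_gt0// ltr_wpDl.
have AN : 0 < A N := lt_le_trans C1 hN.
have := key N; rewrite expr2 !mulrA ler_pM2r//.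
move: hN; rewrite ler_pdivrMr ?mulr_gt0//.
have := ler_norm C; lra.
Qed.

End second_moment.

(** * Walks with Gaussian exponential moments *)

Lemma expRN2_le (R : realType) : expR (- 2) <= 1 / 4 :> R.
Proof.
rewrite expRN div1r lef_pV2 ?posrE ?expR_gt0//.
have -> : expR 2 = expR 1 ^+ 2 :> R by rewrite -expRM_natl mulr1.
by have := @expR_ge1Dx R 1; nra.
Qed.

Lemma expR_le1D2x (R : realType) (x : R) : 0 <= x -> x <= 1 / 2 ->
  expR x <= 1 + 2 * x.
Proof.
move=> x0 x1; have := expR_ge1Dx (- x); rewrite expRN => h.
have ex := expR_gt0 x; rewrite -(ler_pM2r ex) mulVf ?gt_eqF// in h; nra.
Qed.

Section gaussian_walk.
Context (R : realType) (d : measure_display) (T : measurableType d)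
  (P : probability T R).
Variables (W : nat -> T -> R) (V : nat -> R).
Hypothesis mW : forall i, measurable_fun setT (W i).
Hypothesis V0 : forall i, 0 <= V i.
Hypothesis Vnd : forall i j, (i <= j)%N -> V i <= V j.
Hypothesis mgfW : forall i j x y, (i <= j)%N ->
  (\int[P]_w (expR (x * W i w + y * W j w))%:E =
   (expR ((x ^+ 2 * V i + 2 * x * y * V i + y ^+ 2 * V j) / 2))%:E)%E.

(** Scaled to unit variance, the values of [W] at the sparse times [s i] are almost uncorrelated,
    and the second moment method applies to [-2] times them: when they are all nonnegative, every
    normalized exponential is at most exp(-2). The factor [64 * 4 ^+ k.+1] is the square of
    [8 * 2 ^+ k.+1], which makes the covariance [k i j] for [i < j] at most 2^-j / 2 and its
    exponential at most 1 + 2^-j. *)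
Lemma lacunary_nonneg_null (s : nat -> nat) : {homo s : i j / (i <= j)%N} ->
  0 < V (s 0%N) -> (forall k, 64 * 4 ^+ k.+1 * V (s k) <= V (s k.+1)) ->
  P.-negligible [set w | forall i, 0 <= W (s i) w].
Proof.
move=> shom Vs0 Vs.
have Vsnd i j : (i <= j)%N -> V (s i) <= V (s j) by move=> /shom/Vnd.
have Vs_gt0 i : 0 < V (s i) by rewrite (lt_le_trans Vs0)// Vsnd.
pose r i := Num.sqrt (V (s i)).
have r0 i : 0 < r i by rewrite sqrtr_gt0.
have r2 i : r i ^+ 2 = V (s i) by rewrite sqr_sqrtr// ltW.
have rnd i j : (i <= j)%N -> r i <= r j by move=> ij; rewrite ler_wsqrtr// Vsnd.
have rgrow i j : (i < j)%N -> 8 * 2 ^+ j * r i <= r j.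
  case: j => // j ij; apply: (@le_trans _ _ (8 * 2 ^+ j.+1 * r j)).
    by rewrite ler_pM2l ?mulr_gt0 ?exprn_gt0// rnd.
  rewrite -(@ler_pXn2r _ 2) ?nnegrE ?mulr_ge0 ?exprn_ge0 ?(ltW (r0 _))//.
  rewrite !exprMn !r2 exprAC; apply: le_trans (Vs j).
  by rewrite -!natrX.
pose G i w := - 2 / r i * W (s i) w.
pose k i j := 4 * r (minn i j) / r (maxn i j).
have kii i : k i i = 4 by rewrite /k minnn maxnn mulfK ?gt_eqF.
have kC i j : k i j = k j i by rewrite /k minnC maxnC.
have k_lt i j : (i < j)%N -> expR (k i j) <= 1 + (2 ^+ j)^-1.
  move=> ij; rewrite /k (minn_idPl (ltnW ij)) (maxn_idPr (ltnW ij)).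
  have h : 4 * r i / r j <= (2 ^+ j)^-1 / 2.
    have q0 : 0 < (2 : R) ^+ j by rewrite exprn_gt0.
    rewrite ler_pdivrMr//.
    have -> : 4 * r i = (2 ^+ j)^-1 / 2 * (8 * 2 ^+ j * r i) by field; rewrite gt_eqF.
    by rewrite ler_pM2l ?rgrow// divr_gt0 ?invr_gt0.
  apply: (le_trans (expR_le1D2x _ _)).
  - by rewrite divr_ge0 ?mulr_ge0 ?ltW.
  - apply: (le_trans h); rewrite ler_pM2r ?invr_gt0// invf_le1 ?exprn_gt0//.
    by rewrite exprn_ege1// ler1n.
  - by lra.
have i2_ge0 j : 0 <= ((2 : R) ^+ j)^-1 by rewrite invr_ge0 exprn_ge0.
have k_le i j : expR (k i j) <= 1 + (2 ^+ i)^-1 + (2 ^+ j)^-1 + (i == j)%:R * expR 4.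
  have [ij|ji|->] := ltngtP i j.
  - by rewrite mul0r addr0; have := k_lt _ _ ij; have := i2_ge0 i; lra.
  - by rewrite mul0r addr0 kC; have := k_lt _ _ ji; have := i2_ge0 j; lra.
  - by rewrite mul1r kii; have := i2_ge0 j; lra.
have geo N : \sum_(i < N) ((2 : R) ^+ i)^-1 <= 2.
  suff : \sum_(i < N) ((2 : R) ^+ i)^-1 = 2 - 2 * (2 ^+ N)^-1.
    by move=> ->; have := i2_ge0 N; lra.
  elim: N => [|N ih]; first by rewrite big_ord0 expr0 invr1; lra.
  by rewrite big_ord_recr/= ih exprS invfM; field; rewrite gt_eqF// exprn_gt0.
(* Each of the two geometric terms contributes at most [2 * N] and the diagonal [expR 4 * N]. *)
have sumk N : \sum_(i < N) \sum_(j < N) 1 * 1 * expR (k i j) <=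
    (\sum_(i < N) 1) ^+ 2 + (4 + expR 4) * (\sum_(i < N) 1).
  rewrite !sumr_const card_ord.
  apply: (@le_trans _ _ (\sum_(i < N) \sum_(j < N)
    (1 + (2 ^+ i)^-1 + (2 ^+ j)^-1 + (i == j)%:R * expR 4))).
    by apply: ler_sum => i _; apply: ler_sum => j _; rewrite !mul1r -val_eqE k_le.
  apply: (@le_trans _ _ (\sum_(i < N) (N%:R + N%:R * (2 ^+ i)^-1 + 2 + expR 4))).
    apply: ler_sum => i _; rewrite !big_split/= !sumr_const card_ord.
    rewrite -[_^-1 *+ _]mulr_natl; apply: lerD; last first.
      rewrite (bigD1 i)//= eqxx mul1r big1 ?addr0// => j ji.
      by rewrite eq_sym (negbTE ji) mul0r.
    by rewrite lerD2l geo.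
  rewrite !big_split/= !sumr_const card_ord -big_distrr/=.
  have := geo N; have : (0 : R) <= N%:R by [].
  rewrite -[N%:R *+ N]mulr_natr -[expR 4 *+ N]mulr_natr.
  move: (N%:R : R) (\sum_(i < N) _) => n g; nra.
have := @second_moment_null R d T P G k (fun=> 1) (4 + expR 4) _ _ _ _ sumk _.
move=> H; apply: (negligibleS _ (H _ _ _ _ _)).
- move=> w /= Ws i; apply: le_trans (@expRN2_le R); rewrite ler_expR kii /G !mulNr.
  have : 0 <= 2 / r i * W (s i) w by rewrite mulr_ge0 ?Ws ?divr_ge0 ?(ltW (r0 _)).
  by move: (2 / r i * _) => x x0; rewrite (_ : 4 / 2 = 2) ?gerDr ?oppr_le0//; field.
- by move=> i; exact: measurable_funM.
- move=> i; rewrite kii; have := @mgfW (s i) (s i) (- 2 / r i) 0 (leqnn _).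
  under eq_integral do rewrite mul0r addr0; move=> ->.
  congr (expR _)%:E; rewrite -r2; field; rewrite gt_eqF//.
- move=> i j; rewrite !kii.
  wlog ij : i j / (i <= j)%N.
    move=> H'; have [ij|ji] := leqP i j; first exact: H'.
    rewrite kC -(H' j i (ltnW ji)).
    by apply: eq_integral => w _; rewrite addrC.
  have := @mgfW (s i) (s j) (- 2 / r i) (- 2 / r j) (shom _ _ ij); rewrite /G => ->.
  congr (expR _)%:E; rewrite -!r2 /k (minn_idPl ij) (maxn_idPr ij).
  by field; rewrite !gt_eqF.
- by [].
- move=> x; exists (Num.truncn x).+1; rewrite sumr_const card_ord.
  exact/ltW/truncnS_gt.
Qed.

(** Bounded variances keep the means of [expR (W n)] bounded, and Fatou's lemma makes the lower
    limit of [expR (W n)] finite almost surely. Unbounded variances allow the choice of a lacunary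
    subsequence, along which [W] almost surely takes negative values. *)
Lemma gaussian_walk_not_cvgy :
  {ae P, forall w, ~ (W n w @[n --> \oo] --> +oo)}.
Proof.
have [[b Vb]|/forallNP Voo] := pselect (exists b, forall n, V n <= b).
  have mE n : measurable_fun [set: T] (fun w => (expR (W n w))%:E).
    by apply/measurable_EFinP; exact: measurableT_comp.
  have E0 n w : (0 <= (expR (W n w))%:E)%E by rewrite lee_fin expR_ge0.
  have := fatou P measurableT mE (fun n w _ => E0 n w).
  set f := fun w => limn_einf _.
  have mf : measurable_fun [set: T] f.
    have -> : f = (fun w => (- limn_esup (fun n => - (expR (W n w))%:E))%E).
      by apply/funext => w; rewrite -(oppeK (f w)) -limn_esupN.
    apply: measurableT_comp => //; apply: measurable_fun_limn_esup => n.
    exact: measurableT_comp.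
  have f0 w : (0 <= f w)%E.
    rewrite /f limn_einf_lim; apply: lime_ge; first exact: is_cvg_einfs.
    by apply: nearW => n; apply: le_ereal_inf_tmp => _ [m _ <-].
  have fub : (limn_einf (fun n => \int[P]_w (expR (W n w))%:E) <= (expR (b / 2))%:E)%E.
    rewrite limn_einf_lim; apply: lime_le; first exact: is_cvg_einfs.
    apply: nearW => n; apply: (@le_trans _ _ (\int[P]_w (expR (W n w))%:E)%E).
      by apply: ereal_inf_lbound; exists n => /=.
    have := @mgfW n n 1 0 (leqnn n).
    under eq_integral do rewrite mul1r mul0r addr0.
    move=> ->; rewrite lee_fin ler_expR ler_pM2r// mulr0 !mul0r !addr0.
    by rewrite expr0n mul0r addr0 expr1n mul1r.
  move=> /le_trans/(_ fub) intf.
  have fint : P.-integrable setT f.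
    apply/integrableP; split => //.
    under eq_integral do rewrite gee0_abs//.
    exact: (le_lt_trans intf (ltry _)).
  have := integrable_ae measurableT fint; apply: filterS => w /(_ I) ffin Wy.
  suff : f w = +oo%E by move=> fy; rewrite fy in ffin.
  rewrite /f; apply: (cvg_limn_einf_sup _).1.
  apply/cvgeyPge => A; near=> n; rewrite lee_fin.
  apply: (@le_trans _ _ (W n w)); last first.
    by have := expR_ge1Dx (W n w); lra.
  by near: n; move/cvgryPge : Wy; exact.
have hV x : exists n, x <= V n.
  have := Voo x; move/existsNP => [n /negP]; rewrite -ltNge => h.
  by exists n; exact: ltW.
have /choice[g hg] := hV.
pose t := fix t k := if k is k'.+1 then g (64 * 4 ^+ k * V (t k')) else g 1.
have t0 : 1 <= V (t 0%N) by exact: hg.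
have tS k : 64 * 4 ^+ k.+1 * V (t k) <= V (t k.+1) by exact: hg.
have Vt k : 1 <= V (t k).
  elim: k => // k ih; apply: le_trans (tS k).
  have : (1 : R) <= 4 ^+ k.+1 by rewrite exprn_ege1// ler1n.
  move: (4 ^+ k.+1) (V (t k)) ih => x y; nra.
have tlt k : (t k < t k.+1)%N.
  rewrite ltnNge; apply/negP => /Vnd; apply/negP; rewrite -ltNge.
  apply: lt_le_trans (tS k).
  have : (1 : R) <= 4 ^+ k.+1 by rewrite exprn_ege1// ler1n.
  move: (4 ^+ k.+1) (V (t k)) (Vt k) => x y; nra.
have thom : {homo t : i j / (i <= j)%N}.
  by apply: homo_leq => // [i|i]; [exact: leq_trans|exact: ltnW].
have tge k : (k <= t k)%N by elim: k => // k ih; exact: leq_ltn_trans (tlt k).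
(* Convergence to [+oo] gives nonnegative values only from some index on, so every tail of the
   subsequence has to be treated. *)
have nulls p : {ae P, forall w, ~ forall i, 0 <= W (t (p + i)) w}.
  have : P.-negligible [set w | forall i, 0 <= W (t (p + i)%N) w].
    apply: (@lacunary_nonneg_null (fun i => t (p + i)%N)).
    - by move=> i j ij; apply: thom; rewrite leq_add2l.
    - by rewrite (lt_le_trans _ (Vt _)).
    - move=> k; rewrite addnS; apply: le_trans (tS _).
      rewrite ler_wpM2r// ler_pM2l// ler_weXn2l// ?ler1n//.
      by rewrite ltnS leq_addl.
  apply: negligibleS => w /= /contrapT; exact.
have := ae_foralln nulls; apply: filterS => w hw Wy.
have /cvgryPge/(_ 0)[N _ hN] := Wy.
by apply: (hw N) => i; apply: hN => /=; rewrite (leq_trans _ (tge _))// leq_addr.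
Unshelve. all: by end_near.
Qed.

End gaussian_walk.

(** * Increments with Gaussian exponential moments *)

Lemma sum_delta (R : pzRingType) (L l : nat) (F : nat -> R) : (l < L)%N ->
  \sum_(i < L) (i == l :> nat)%:R * F i = F l.
Proof.
move=> lL; rewrite (bigD1 (Ordinal lL))//= eqxx mul1r big1 ?addr0// => i.
by rewrite -val_eqE/= => /negbTE ->; rewrite mul0r.
Qed.

Section gaussian_increments.
Context (R : realType) (d : measure_display) (T : measurableType d)
  (P : probability T R).
Variables (D : nat -> T -> R) (v : nat -> R).
Hypothesis mD : forall l, measurable_fun setT (D l).
Hypothesis mgfD : forall (a : nat -> R) (L : nat),
  (\int[P]_w (expR (\sum_(l < L) a l * D l w))%:E
     = (expR (\sum_(l < L) a l ^+ 2 * v l / 2))%:E)%E.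

Lemma incr_mgf2 l1 l2 x y :
  (\int[P]_w (expR (x * D l1 w + y * D l2 w))%:E =
   (expR ((x ^+ 2 * v l1 + y ^+ 2 * v l2) / 2 +
     (l1 == l2)%:R * (x * y * v l1)))%:E)%E.
Proof.
pose a l := (l == l1)%:R * x + (l == l2)%:R * y.
pose L := (maxn l1 l2).+1.
have L1 : (l1 < L)%N by rewrite ltnS leq_maxl.
have L2 : (l2 < L)%N by rewrite ltnS leq_maxr.
have := mgfD a L; rewrite (_ : \sum_(l < L) a l ^+ 2 * v l / 2 =
  (x ^+ 2 * v l1 + y ^+ 2 * v l2) / 2 + (l1 == l2)%:R * (x * y * v l1)); last first.
  rewrite mulrDl -(sum_delta (fun l => x ^+ 2 * v l / 2) L1).
  rewrite -(sum_delta (fun l => y ^+ 2 * v l / 2) L2).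
  rewrite -(sum_delta (fun l => (l == l2)%:R * (x * y * v l)) L1).
  rewrite -!big_split/=; apply: eq_bigr => l _; rewrite /a.
  by case: (_ == l1); case: (_ == l2); rewrite ?mul1r ?mul0r; field.
move=> <-; apply: eq_integral => w _; congr (expR _)%:E.
rewrite -(sum_delta (fun l => x * D l w) L1) -(sum_delta (fun l => y * D l w) L2).
by rewrite -big_split/=; apply: eq_bigr => l _; rewrite /a mulrDl !mulrA.
Qed.

Lemma incr_mgf l x :
  (\int[P]_w (expR (x * D l w))%:E = (expR (x ^+ 2 * v l / 2))%:E)%E.
Proof.
have := incr_mgf2 l l x 0; under eq_integral do rewrite mul0r addr0.
by move=> ->; rewrite expr0n mul0r addr0 mulr0 mul0r mulr0 addr0.
Qed.

Lemma walk_mgf i j x y : (i <= j)%N ->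
  (\int[P]_w (expR (x * (\sum_(l < i) D l w) + y * (\sum_(l < j) D l w)))%:E =
   (expR ((x ^+ 2 * (\sum_(l < i) v l) + 2 * x * y * (\sum_(l < i) v l) +
     y ^+ 2 * (\sum_(l < j) v l)) / 2))%:E)%E.
Proof.
move=> ij; rewrite -(subnKC ij); set m := (j - i)%N.
(* Increments below [i] enter both sums, the later ones the second sum only. *)
pose a l := (l < i)%:R * x + y.
have ai (l : 'I_i) : a (lshift m l) = x + y by rewrite /a /= ltn_ord mul1r.
have am (l : 'I_m) : a (rshift i l) = y.
  by rewrite /a /= ltnNge leq_addr/= mul0r add0r.
have := mgfD a (i + m); rewrite big_split_ord/=.
under [in RHS]eq_bigr do rewrite -/(lshift m _) ai.
under [X in _ + X]eq_bigr do rewrite am.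
rewrite -!big_distrl/= -!big_distrr/= => E.
transitivity ((expR ((x + y) ^+ 2 * (\sum_(i0 < i) v i0) / 2 +
  y ^+ 2 * (\sum_(i0 < m) v (i + i0)%N) / 2))%:E)%E; last first.
  by rewrite big_split_ord/=; congr (expR _)%:E; field.
rewrite -E; apply: eq_integral => w _; congr (expR _)%:E.
rewrite !big_split_ord/= mulrDr addrA -mulrDl !big_distrr/=.
congr (_ + _); apply: eq_bigr => l _; first by rewrite ai.
by rewrite am.
Qed.

(* The mean-one variables exp(K D_i / v_i - K^2 / (2 v_i)) are tiny when
   D_i <= K / 4, and their second moments exp(K^2 / v_i) are compensated by the
   weights exp(- K^2 / v_i). *)
Lemma small_incr_bounded (K : R) (m : nat) : 0 < K -> (forall l, 0 < v l) ->
  (forall l, v (m + l)%N <= K ^+ 2 / 8) ->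
  {ae P, forall w, D n w @[n --> \oo] --> 0} ->
  exists M, forall n, \sum_(i < n) expR (- (K ^+ 2 / v (m + i)%N)) <= M.
Proof.
move=> K0 vp vK D0; apply: contrapT => /forallNP Moo.
pose c i := expR (- (K ^+ 2 / v i)).
have cpos i : 0 <= c i by exact: expR_ge0.
have nulls p : {ae P, forall w, ~ forall i,
    expR (K / v (m + p + i)%N * D (m + p + i)%N w - K ^+ 2 / v (m + p + i)%N / 2) <= 1 / 4}.
  have : P.-negligible [set w | forall i,
    expR (K / v (m + p + i)%N * D (m + p + i)%N w - K ^+ 2 / v (m + p + i)%N / 2) <= 1 / 4].
    have := @second_moment_null R d T P
      (fun i w => K / v (m + p + i)%N * D (m + p + i)%N w)
      (fun i j => (i == j)%:R * (K ^+ 2 / v (m + p + i)%N))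
      (fun i => c (m + p + i)%N) 1.
    move=> H; apply: (negligibleS _ (H _ _ _ _ _ _)).
    - by move=> w h i; rewrite eqxx (mul1r (K ^+ 2 / _)); exact: h.
    - by move=> i; exact: measurable_funM.
    - move=> i; rewrite incr_mgf eqxx (mul1r (K ^+ 2 / _)); congr (expR _)%:E.
      by field; rewrite gt_eqF.
    - move=> i j; rewrite incr_mgf2 !eqxx !(mul1r (K ^+ 2 / _)) eqn_add2l.
      congr (expR _)%:E.
      have [->|ij] := eqVneq i j; first by rewrite !mul1r; field; rewrite gt_eqF.
      by rewrite !mul0r; field; rewrite !gt_eqF.
    - by move=> i; exact: cpos.
    (* Off the diagonal the covariance is 0 and the terms are those of the squared sum; on the
       diagonal the weight cancels one second moment and leaves [c] itself, hence the constant 1. *)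
    - move=> N; rewrite (mul1r (\sum_(i < N) _)) [X in _ <= X + _]expr2 big_distrlr/= -big_split/=.
      apply: ler_sum => i _.
      rewrite (bigD1 i)//= [X in _ <= X + _](bigD1 i)//= eqxx.
      rewrite (mul1r (K ^+ 2 / _)) -mulrA {2}/c -expRD addNr expR0 mulr1.
      rewrite (eq_bigr (fun j : 'I_N => c (m + p + i)%N * c (m + p + j)%N)).
        by rewrite [leRHS]addrC lerD2l lerDr mulr_ge0.
      move=> j; rewrite -val_eqE eq_sym => /negbTE/= ->.
      by rewrite mul0r expR0 mulr1.
    - move=> x.
      have [N hN] : exists N, x + \sum_(i < p) c (m + i)%N <= \sum_(i < N) c (m + i)%N.
        have := Moo (x + \sum_(i < p) c (m + i)%N) => /existsNP[N /negP].
        by rewrite -ltNge => h; exists N; exact: ltW.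
      exists N.
      have : \sum_(i < N) c (m + i)%N <= \sum_(i < p + N) c (m + i)%N.
        by rewrite addnC big_split_ord/= lerDl sumr_ge0.
      rewrite big_split_ord/=.
      under [X in _ <= _ + X -> _]eq_bigr do rewrite addnA.
      by move: hN; lra.
  apply: negligibleS => w /= /contrapT; exact.
(* The goal no longer depends on [w]: a contradiction on almost every path is a contradiction,
   because almost everywhere is a proper filter for a probability. *)
have P1 : (0 < P [set: T])%E by rewrite probability_setT.
have FP := ae_properfilter_algebraOfSetsType P1.
apply: (@filter_const _ _ FP).
  apply: filterS2 (ae_foralln nulls) D0 => w hw.
  have K4 : 0 < K / 4 by rewrite divr_gt0.
  move/cvgrPdist_le => /(_ _ K4)[N _ hN].
  apply: (hw N) => i; set l := (m + N + i)%N.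
  apply: le_trans (expRN2_le R); rewrite ler_expR.
  have Dl : D l w <= K / 4.
    have := hN l; rewrite /= sub0r normrN => h.
    by rewrite (le_trans (ler_norm _))// h// /l -addnA addnCA leq_addr.
  have vl : v l <= K ^+ 2 / 8 by rewrite /l -addnA.
  (* With [D l w <= K / 4] the exponent is at most [- K ^+ 2 / (4 * v l)], and [v l <= K ^+ 2 / 8]
     brings it to [-2] or below. *)
  have -> : K / v l * D l w - K ^+ 2 / v l / 2 = (K * D l w - K ^+ 2 / 2) / v l.
    by field; rewrite gt_eqF.
  rewrite ler_pdivrMr//.
  have : K * D l w <= K * (K / 4) by rewrite ler_pM2l.
  by rewrite mulrA -expr2; lra.
Qed.

End gaussian_increments.

(** * From bounded exponential weights to the logarithmic decay of [sigma ^+ 2] *)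

Section fading.
Context (R : realType) (sigma : R -> R) (v : nat -> R).
Hypothesis sigma_decr :
  forall s t, 0 <= s -> s <= t -> sigma t ^+ 2 <= sigma s ^+ 2.
Hypothesis sigma_v : forall l, sigma l.+1%:R ^+ 2 <= v l <= sigma l%:R ^+ 2.

Let vS l : sigma l.+1%:R ^+ 2 <= v l. Proof. by case/andP: (sigma_v l). Qed.
Let v_ge0 l : 0 <= v l. Proof. by rewrite (le_trans _ (vS l))// sqr_ge0. Qed.
Let v_decr l m : (l <= m)%N -> v m <= v l.
Proof.
rewrite leq_eqVlt => /predU1P[->//|lm].
apply: le_trans (vS l); have /andP[_ vm] := sigma_v m; apply: (le_trans vm).
by apply: sigma_decr => //; rewrite ler_nat.
Qed.

Lemma ln_nat_cvgy (x : R) : \forall n \near \oo, x <= ln n.+1%:R.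
Proof.
exists (Num.truncn (expR x)) => // n /= hn.
rewrite -ler_expR lnK ?posrE// (le_trans (ltW (truncnS_gt _)))//.
by rewrite ler_nat ltnS.
Qed.

(** The weights are nonincreasing, so [n.+1] times the last of the first [n.+1] of them is at most
    [M]; take logarithms. *)
Lemma bounded_weights_log (K M : R) (m : nat) : (forall l, 0 < v l) ->
  (forall n, \sum_(i < n) expR (- (K ^+ 2 / v (m + i)%N)) <= M) ->
  0 < M /\ forall n, v (m + n)%N * (ln n.+1%:R - ln M) <= K ^+ 2.
Proof.
move=> vp hM.
have M0 : 0 < M.
  by apply: lt_le_trans (hM 1%N); rewrite big_ord1 expR_gt0.
split=> // n.
have : n.+1%:R * expR (- (K ^+ 2 / v (m + n)%N)) <= M.
  apply: le_trans (hM n.+1).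
  apply: (@le_trans _ _ (\sum_(i < n.+1) expR (- (K ^+ 2 / v (m + n)%N)))).
    by rewrite sumr_const card_ord mulr_natl.
  apply: ler_sum => i _; rewrite ler_expR lerN2 ler_wpM2l ?sqr_ge0//.
  by rewrite lef_pV2 ?posrE// v_decr// leq_add2l -ltnS ltn_ord.
move=> h; have {h} : ln (n.+1%:R * expR (- (K ^+ 2 / v (m + n)%N))) <= ln M.
  by rewrite ler_ln ?posrE// mulr_gt0// expR_gt0.
rewrite lnM ?posrE ?expR_gt0// expRK => h.
have {h} : ln n.+1%:R - ln M <= K ^+ 2 / v (m + n)%N by lra.
by rewrite ler_pdivlMr// mulrC.
Qed.

Lemma fading_of_bounded_weights :
  (forall (K : R) (m : nat), 0 < K -> (forall l, 0 < v l) ->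
    (forall l, v (m + l)%N <= K ^+ 2 / 8) ->
    exists M, forall n, \sum_(i < n) expR (- (K ^+ 2 / v (m + i)%N)) <= M) ->
  sigma t ^+ 2 * ln t @[t --> +oo] --> 0.
Proof.
move=> H.
(* If some [v i] vanishes, so does [sigma] from [i.+1] on. *)
have [[i vi]|/forallNP vpos] := pselect (exists i, v i <= 0).
  have s0 t : i.+1%:R <= t -> sigma t ^+ 2 = 0.
    move=> it; apply/eqP; rewrite eq_le sqr_ge0 andbT.
    apply: le_trans vi; apply: le_trans (vS i).
    exact: sigma_decr.
  apply: cvg_near_cst; exists i.+1%:R; split; first exact: num_real.
  by move=> t it; rewrite s0 ?mul0r// ltW.
have vp l : 0 < v l by rewrite ltNge; apply/negP/vpos.
(* The assumption requires [v] to be small compared with [K ^+ 2]. Taking [K ^+ 2 = 8 * v 0] makes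
   this automatic, and the outcome, that [v] becomes arbitrarily small, then admits every [K] from
   some index on. *)
have vlim e : 0 < e -> exists m, v m <= e.
  move=> e0; have k0 : 0 < Num.sqrt (8 * v 0%N) by rewrite sqrtr_gt0 mulr_gt0.
  have k2 : Num.sqrt (8 * v 0%N) ^+ 2 = 8 * v 0%N by rewrite sqr_sqrtr// ltW// mulr_gt0.
  have [] := H _ 0%N k0 vp.
    by move=> l; rewrite k2 mulrAC divff// mul1r v_decr.
  move=> M /(bounded_weights_log vp)[M0 hM].
  have [N _ /(_ N (leqnn _)) hN] := ln_nat_cvgy (8 * v 0%N / e + ln M).
  exists N; rewrite leNgt; apply/negP => ev.
  have := hM N; rewrite k2 add0n; apply/negP; rewrite -ltNge.
  have h : 8 * v 0%N / e <= ln N.+1%:R - ln M by move: hN => /=; lra.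
  have q0 : 0 < 8 * v 0%N / e by rewrite divr_gt0// mulr_gt0.
  apply: (@lt_le_trans _ _ (v N * (8 * v 0%N / e))); last by rewrite ler_pM2l.
  have -> : 8 * v 0%N = e * (8 * v 0%N / e) by field; rewrite gt_eqF.
  have -> : e * (8 * v 0%N / e) / e = 8 * v 0%N / e by field; rewrite gt_eqF.
  by rewrite ltr_pM2r.
apply/cvgrPdist_le => e e0.
(* The factor 2 pays for the shift of index: for large [n], ln (m + n + 2) is at most twice
   [ln n.+1%:R - ln M]. *)
pose K := Num.sqrt (e / 2).
have K0 : 0 < K by rewrite sqrtr_gt0 divr_gt0.
have K2 : K ^+ 2 = e / 2 by rewrite sqr_sqrtr// ltW// divr_gt0.
have [m hm] : exists m, v m <= K ^+ 2 / 8 by apply: vlim; rewrite divr_gt0 ?exprn_gt0.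
have [M] : exists M, forall n, \sum_(i < n) expR (- (K ^+ 2 / v (m + i)%N)) <= M.
  by apply: H => // l; rewrite (le_trans _ hm)// v_decr// leq_addr.
move=> /(bounded_weights_log vp)[M0 hM].
have [N _ hN] := ln_nat_cvgy (ln m.+2%:R + 2 * ln M).
near=> t.
have t1 : 1 <= t by near: t; exact: nbhs_pinfty_ge.
have lnt : 0 <= ln t by exact: ln_ge0.
rewrite sub0r normrN ger0_norm; last by apply: mulr_ge0 => //; exact: sqr_ge0.
(* Thus [t] lies between m + n + 1 and m + n + 2, so that [sigma t ^+ 2] is at most [v (m + n)]. *)
pose n := (Num.truncn t - m.+1)%N.
have tN : (m.+1 + N <= Num.truncn t)%N.
  by rewrite truncn_ge_nat; [near: t; exact: nbhs_pinfty_ge|lra].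
have tn : Num.truncn t = (m + n).+1 by rewrite /n; lia.
have Nn : (N <= n)%N by rewrite /n; lia.
have /andP[nt tn1] := truncn_itv (le_trans ler01 t1).
rewrite tn in nt tn1.
apply: (@le_trans _ _ (v (m + n)%N * ln (m + n).+2%:R)).
  apply: ler_pM => //; first exact: sqr_ge0.
    by apply: le_trans (vS _); exact: sigma_decr.
  by rewrite ler_ln ?posrE ?ltW//; lra.
have lnmn : ln (m + n).+2%:R <= ln m.+2%:R + ln n.+1%:R :> R.
  rewrite -lnM ?posrE// ler_ln ?posrE ?mulr_gt0// -natrM ler_nat; lia.
have := hN n Nn; have := hM n; rewrite K2 => h1 /= h2.
apply: (@le_trans _ _ (v (m + n)%N * (2 * (ln n.+1%:R - ln M)))).
  by rewrite ler_pM2l//; lra.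
by rewrite mulrCA; lra.
Unshelve. all: by end_near.
Qed.

End fading.

(** * Dyadic chaining *)

Section dyadic_chaining.
Context (R : realType).
Implicit Types (g : R -> R) (n : nat).

Definition dyad (m i : nat) : R := i%:R / 2 ^+ m.

Lemma dyad0 i : dyad 0 i = i%:R. Proof. by rewrite /dyad expr0 divr1. Qed.

Lemma dyad_double m i : dyad m.+1 (i * 2) = dyad m i.
Proof.
by rewrite /dyad natrM exprSr invfM mulrACA mulfV ?mulr1// pnatr_eq0.
Qed.

Lemma dyad_trunc m (t : R) : 0 <= t ->
  dyad m (Num.truncn (t * 2 ^+ m)) <= t < dyad m (Num.truncn (t * 2 ^+ m)).+1.
Proof.
move=> t0; have p0 : 0 < (2 : R) ^+ m by rewrite exprn_gt0.
rewrite /dyad ler_pdivrMr// ltr_pdivlMr//.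
by rewrite truncn_itv// mulr_ge0// ltW.
Qed.

Lemma dyad_trunc_cvg (t : R) : 0 <= t ->
  dyad m (Num.truncn (t * 2 ^+ m)) @[m --> \oo] --> t.
Proof.
move=> t0; apply/cvgrPdist_lt => e e0.
have : (1 : R) / 2 ^+ p @[p --> \oo] --> (0 : R).
  under eq_fun do rewrite -exprVn.
  by apply: cvg_geometric; rewrite ger0_norm ?invr_ge0// invf_lt1// ltr1n.
move=> /cvgrPdist_lt/(_ e e0)[N _ hN]; exists N => // m /hN /=.
rewrite sub0r normrN ger0_norm ?divr_ge0 ?exprn_ge0// => h.
have /andP[h1 h2] := dyad_trunc m t0.
rewrite ger0_norm ?subr_ge0// (lt_trans _ h)// ltrBlDl.
by move: h2; rewrite /dyad -natr1 mulrDl.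
Qed.

(* The lower dyadic approximation of t of order m + 1 is that of order m or the
   next point of the grid of mesh 2^-(m+1). *)
Lemma chaining_bound g n (eta : R) : 0 <= eta ->
  (forall t, n%:R <= t -> {for t, continuous g}) ->
  (forall m k, (k < 2 ^ m)%N ->
    `|g (dyad m (n * 2 ^ m + k).+1) - g (dyad m (n * 2 ^ m + k))|
      <= eta * (3 / 4) ^+ m) ->
  forall t, n%:R <= t -> t < n.+1%:R -> `|g t - g n%:R| <= 4 * eta.
Proof.
move=> eta0 cg step t nt tn.
have t0 : 0 <= t by rewrite (le_trans _ nt).
pose i m := Num.truncn (t * 2 ^+ m).
have p0 m : 0 < (2 : R) ^+ m by rewrite exprn_gt0.
have i_ge m : (n * 2 ^ m <= i m)%N.
  by rewrite truncn_ge_nat ?mulr_ge0 ?(ltW (p0 m))// natrM natrX ler_pM2r.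
have i_lt m : (i m < n.+1 * 2 ^ m)%N.
  rewrite -(ltr_nat R); apply: (@le_lt_trans _ _ (t * 2 ^+ m)).
    by have /andP[] := truncn_itv (mulr_ge0 t0 (ltW (p0 m))).
  by rewrite natrM natrX ltr_pM2r.
have iS m : i m.+1 = (i m * 2)%N \/ i m.+1 = (i m * 2).+1.
  have /andP[h1 h2] := truncn_itv (mulr_ge0 t0 (ltW (p0 m))).
  have /andP[h3 h4] := truncn_itv (mulr_ge0 t0 (ltW (p0 m.+1))).
  rewrite -/(i m) -/(i m.+1) in h1 h2 h3 h4.
  have : (i m * 2 < (i m.+1).+1)%N.
    rewrite -(ltr_nat R) natrM (le_lt_trans _ h4)// exprSr mulrA ler_pM2r//.
  have : (i m.+1 < (i m).+1 * 2)%N.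
    rewrite -(ltr_nat R) natrM (le_lt_trans h3)// exprSr mulrA ltr_pM2r//.
  by lia.
(* The factor [4 - 4 * (3 / 4) ^+ m] is the sum of (3/4)^k over k < m, which dominates the steps of
   orders 1 to m. *)
have iP m : `|g (dyad m (i m)) - g n%:R| <= eta * (4 - 4 * (3 / 4) ^+ m).
  elim: m => [|m ih].
    have -> : i 0%N = n.
      by apply/eqP; have := i_ge 0%N; have := i_lt 0%N; rewrite expn0 !muln1; lia.
    by rewrite dyad0 subrr normr0 expr0 mulr1 subrr mulr0.
  have d1 : `|g (dyad m.+1 (i m.+1)) - g (dyad m (i m))| <= eta * (3 / 4) ^+ m.+1.
    rewrite -[dyad m (i m)]dyad_double; have [->|E] := iS m.
      by rewrite subrr normr0 mulr_ge0// exprn_ge0// divr_ge0.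
    have := step m.+1 (i m * 2 - n * 2 ^ m.+1)%N.
    rewrite subnKC; last by rewrite expnSr mulnA leq_mul2r i_ge orbT.
    rewrite -E; apply; have := i_lt m; have := i_ge m; rewrite expnSr; nia.
  rewrite -(subrKA (g (dyad m (i m)))) (le_trans (ler_normD _ _))//.
  apply: (le_trans (lerD d1 ih)); rewrite exprS -mulrDr ler_wpM2l//.
  have : 0 <= ((3 : R) / 4) ^+ m by rewrite exprn_ge0// divr_ge0.
  lra.
have gt : g (dyad m (i m)) @[m --> \oo] --> g t.
  by apply: (cvg_comp _ g (dyad_trunc_cvg t0)); exact: cg.
have : `|g (dyad m (i m)) - g n%:R| @[m --> \oo] --> `|g t - g n%:R|.
  by apply: cvg_norm; apply: cvgB => //; exact: cvg_cst.
move=> cv; rewrite -(cvg_lim _ cv)//; apply: limr_le; first exact: cvgP cv.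
apply: nearW => m; apply: (le_trans (iP m)); rewrite mulrC ler_wpM2r//.
by rewrite gerBl mulr_ge0// exprn_ge0// divr_ge0.
Qed.

(** Between the integer parts of [s] and [t] there are at most [t - s + 1] unit steps; with the two
    end pieces the total is at most [dl * (t - s + 3)]. *)
Lemma slow_growth_of_unit_steps g (N : nat) (dl : R) : 0 <= dl ->
  (forall n t, (N <= n)%N -> n%:R <= t -> t < n.+1%:R -> `|g t - g n%:R| <= dl) ->
  (forall n, (N <= n)%N -> `|g n.+1%:R - g n%:R| <= dl) ->
  forall s t, N%:R <= s -> s <= t -> `|g t - g s| <= 3 * dl * (1 + (t - s)).
Proof.
move=> dl0 h h1 s t Ns st.
have s0 : 0 <= s by rewrite (le_trans _ Ns).
have t0 : 0 <= t by rewrite (le_trans s0).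
have /andP[a1 a2] := truncn_itv s0; have /andP[b1 b2] := truncn_itv t0.
set a := Num.truncn s in a1 a2; set b := Num.truncn t in b1 b2.
have Na : (N <= a)%N by rewrite truncn_ge_nat.
have ab : (a <= b)%N by rewrite truncn_ge_nat// (le_trans a1).
have hab k : `|g (a + k)%:R - g a%:R| <= dl * k%:R.
  elim: k => [|k ih]; first by rewrite addn0 subrr normr0 mulr0.
  rewrite -(subrKA (g (a + k)%:R)) (le_trans (ler_normD _ _))//.
  rewrite addnS -[k.+1%:R]natr1 mulrDr mulr1 addrC; apply: lerD => //.
  by apply: h1 => //; rewrite (leq_trans Na)// leq_addr.
have := hab (b - a)%N; rewrite subnKC// natrB// => hba.
have hs := h a s Na a1 a2; have ht := h b t (leq_trans Na ab) b1 b2.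
have -> : g t - g s = (g t - g b%:R) + (g b%:R - g a%:R) - (g s - g a%:R) by ring.
apply: (le_trans (ler_normB _ _)); apply: (le_trans (lerD (ler_normD _ _) (lexx _))).
rewrite -!natr1 in a2 b2.
have q : b%:R - a%:R <= t - s + 1 by lra.
have := ler_wpM2l dl0 q; nra.
Qed.

End dyadic_chaining.

(** * Subgaussian tails and almost sure slow growth of the integral *)

Section tails.
Context (R : realType) (d : measure_display) (T : measurableType d)
  (P : probability T R).

Lemma markov_set (A : set T) (f : T -> R) (c : R) : measurable A ->
  measurable_fun setT f -> (forall w, 0 <= f w) -> 0 <= c ->
  (forall w, A w -> c <= f w) -> (c%:E * P A <= \int[P]_w (f w)%:E)%E.
Proof.
move=> mA mf f0 c0 Af.
rewrite -[X in (_ * P X)%E]setIT -integral_indic//.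
rewrite -ge0_integralZl_EFin//; last exact/measurable_EFinP.
apply: ge0_le_integral => //.
- by move=> w _; rewrite -EFinM lee_fin mulr_ge0.
- by apply: measurable_funeM; exact/measurable_EFinP.
- exact/measurable_EFinP.
- move=> w _; rewrite -EFinM lee_fin indicE.
  by have [/set_mem/Af|_] := boolP (w \in A); rewrite ?mulr1 ?mulr0.
Qed.

(** Chernoff's bound, at the minimizer [x = y / s] of [x ^+ 2 * s / 2 - x * y]. *)
Lemma subgaussian_tail1 (D : T -> R) (s y : R) : measurable_fun setT D ->
  0 < s -> 0 < y ->
  (forall x, \int[P]_w (expR (x * D w))%:E <= (expR (x ^+ 2 * s / 2))%:E)%E ->
  (P [set w | (y <= D w)%R] <= (expR (- (y ^+ 2 / (2 * s))))%:E)%E.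
Proof.
move=> mD s0 y0 mgf.
have mA : measurable [set w | y <= D w].
  have -> : [set w | y <= D w] = setT `&` D @^-1` `[y, +oo[.
    by rewrite setTI; apply/seteqP; split => w /=; rewrite in_itv/= andbT.
  by apply: mD => //; exact: measurable_itv.
have mE : measurable_fun [set: T] (fun w => expR (y / s * D w)).
  by apply: measurableT_comp => //; exact: measurable_funM.
have h := @markov_set _ (fun w => expR (y / s * D w)) (expR (y / s * y)) mA mE
  (fun=> expR_ge0 _) (expR_ge0 _).
rewrite -(@lee_pmul2l _ (expR (y / s * y))%:E) ?lte_fin ?expR_gt0//.
apply: (le_trans (h _)).
  by move=> w /= yD; rewrite ler_expR ler_pM2l// divr_gt0.
apply: (le_trans (mgf _)); rewrite -EFinM -expRD lee_fin ler_expR.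
by rewrite le_eqVlt; apply/orP; left; apply/eqP; field; rewrite gt_eqF.
Qed.

Lemma subgaussian_tail (D : T -> R) (s y : R) : measurable_fun setT D ->
  0 < s -> 0 < y ->
  (forall x, \int[P]_w (expR (x * D w))%:E <= (expR (x ^+ 2 * s / 2))%:E)%E ->
  (P [set w | (y <= `|D w|)%R] <= (2 * expR (- (y ^+ 2 / (2 * s))))%:E)%E.
Proof.
move=> mD s0 y0 mgf.
have mge (E : T -> R) : measurable_fun setT E -> measurable [set w | y <= E w].
  move=> mE; have -> : [set w | y <= E w] = setT `&` E @^-1` `[y, +oo[.
    by rewrite setTI; apply/seteqP; split => w /=; rewrite in_itv/= andbT.
  by apply: mE => //; exact: measurable_itv.
have mN : measurable_fun [set: T] (fun w => - D w) by exact: measurableT_comp.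
have -> : [set w | y <= `|D w|] = [set w | y <= D w] `|` [set w | y <= - D w].
  apply/seteqP; split => w /=; last first.
    by case=> /le_trans; apply; rewrite ?ler_norm// -normrN ler_norm.
  by rewrite ler_normr => /orP.
apply: (le_trans (measureU2 _ _ _)); [exact: mge|exact: mge|].
have -> : (2 * expR (- (y ^+ 2 / (2 * s))))%:E =
    ((expR (- (y ^+ 2 / (2 * s))))%:E + (expR (- (y ^+ 2 / (2 * s))))%:E)%E :> \bar R.
  by rewrite -EFinD mulr_natl mulr2n.
apply: leeD; apply: subgaussian_tail1 => // x.
by under eq_integral do rewrite mulrN -mulNr; rewrite -[x ^+ 2]sqrrN.
Qed.

End tails.

Lemma nneseries_le_cst (R : realType) (u : nat -> \bar R) (c : \bar R) :
  (forall n, 0 <= u n)%E -> (forall n, \sum_(i < n) u i <= c)%E ->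
  (\sum_(0 <= n <oo) u n <= c)%E.
Proof.
move=> u0 uc; apply: lime_le; first by apply: is_cvg_nneseries.
by apply: nearW => n; rewrite big_mkord.
Qed.

Section almost_sure_slow_growth.
Context (R : realType) (d : measure_display) (T : measurableType d)
  (P : probability T R).
Variables (J : R -> T -> R) (sigma : R -> R).
Hypothesis mJ : forall t, 0 <= t -> measurable_fun setT (J t).
Hypothesis cJ : continuous_process P J.
Hypothesis sigma_decr :
  forall s t, 0 <= s -> s <= t -> sigma t ^+ 2 <= sigma s ^+ 2.
Hypothesis mgfJ : forall m l x,
  (\int[P]_w (expR (x * (J (dyad R m l.+1) w - J (dyad R m l) w)))%:E <=
   (expR (x ^+ 2 * (sigma (dyad R m l) ^+ 2 / 2 ^+ m) / 2))%:E)%E.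
Hypothesis sigma_ln : sigma t ^+ 2 * ln t @[t --> +oo] --> 0.

Let dyad_ge0 m l : 0 <= dyad R m l.
Proof. by rewrite divr_ge0// exprn_ge0. Qed.

(** The thresholds are summable in [m], yet decrease more slowly than the standard deviations, of
    order 2^(-m/2): the squared ratio grows like (9/8)^m. *)
Let big_step eta n m k := [set w | eta * (3 / 4) ^+ m <=
  `|J (dyad R m (n * 2 ^ m + k).+1) w - J (dyad R m (n * 2 ^ m + k)) w|].

Let mincr m l : measurable_fun [set: T]
  (fun w => J (dyad R m l.+1) w - J (dyad R m l) w).
Proof. by apply: measurable_funB; exact: mJ. Qed.

Let mbig_step eta n m k : measurable (big_step eta n m k).
Proof.
have -> : big_step eta n m k = setT `&` (fun w => `|J (dyad R m (n * 2 ^ m + k).+1) w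
    - J (dyad R m (n * 2 ^ m + k)) w|) @^-1` `[eta * (3 / 4) ^+ m, +oo[.
  by rewrite setTI; apply/seteqP; split => w /=; rewrite in_itv/= andbT.
have : measurable_fun [set: T] (fun w => `|J (dyad R m (n * 2 ^ m + k).+1) w
    - J (dyad R m (n * 2 ^ m + k)) w|).
  by apply: measurableT_comp => //; exact: mincr.
by apply => //; exact: measurable_itv.
Qed.

Lemma bernoulli98 m : 1 + m%:R / 8 <= (9 / 8) ^+ m :> R.
Proof.
elim: m => [|m ih]; first by rewrite mul0r addr0 expr0.
rewrite exprS -natr1; have : (0 : R) <= m%:R by [].
by move: ih; move: (m%:R : R) ((9 / 8) ^+ m : R) => x y; lra.
Qed.

(** The assumption on [sigma] makes the tail exponent at least 2 ln n (9/8)^m, which has to exceed 2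
    ln n + 2 m ln 2. Bernoulli's inequality reduces this to ln n >= 8 ln 2, that is n >= 256. The
    factor 4^-m outweighs the 2^m steps of level [m]. *)
Lemma big_step_prob eta n m k : 0 < eta -> (256 <= n)%N ->
  sigma n%:R ^+ 2 <= eta ^+ 2 / (4 * ln n%:R) ->
  (P (big_step eta n m k) <= (2 / (n%:R ^+ 2 * 4 ^+ m))%:E)%E.
Proof.
move=> eta0 n256 hs.
have n0 : 0 < n%:R :> R by rewrite ltr0n; lia.
have ln2 : 0 < ln 2 :> R by rewrite ln_gt0// ltr1n.
have Ln : 8 * ln 2 <= ln n%:R :> R.
  have -> : 8 * ln 2 = ln (2 ^+ 8) :> R by rewrite lnXn// mulr_natl.
  by rewrite ler_ln ?posrE ?exprn_gt0// -natrX ler_nat.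
have L0 : 0 < ln n%:R :> R by rewrite (lt_le_trans _ Ln)// mulr_gt0.
set L := ln n%:R in L0 Ln hs *.
have q0 : 0 < (2 : R) ^+ m by rewrite exprn_gt0.
pose s := eta ^+ 2 / (4 * L) / 2 ^+ m.
have s0 : 0 < s by rewrite !divr_gt0 ?exprn_gt0 ?mulr_gt0.
have y0 : 0 < eta * (3 / 4) ^+ m by rewrite mulr_gt0// exprn_gt0// divr_gt0.
apply: (le_trans (@subgaussian_tail R d T P _ s _ (mincr _ _) s0 y0 _)).
  move=> x; apply: (le_trans (mgfJ _ _ _)); rewrite lee_fin ler_expR.
  rewrite ler_pM2r ?invr_gt0// ler_wpM2l ?sqr_ge0// ler_pM2r ?invr_gt0//.
  apply: le_trans hs; apply: sigma_decr => //.
  by rewrite /dyad ler_pdivlMr// -natrX -natrM ler_nat leq_addr.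
rewrite lee_fin ler_pM2l//.
have -> : (eta * (3 / 4) ^+ m) ^+ 2 / (2 * s) = 2 * L * (9 / 8) ^+ m.
  have -> : (9 : R) / 8 = 2 * (3 / 4) ^+ 2 by field.
  rewrite [in RHS]exprMn [in RHS]exprAC /s exprMn; field.
  by rewrite !gt_eqF.
have -> : (n%:R ^+ 2 * 4 ^+ m)^-1 = expR (- (2 * L + (2 * ln 2) * m%:R)) :> R.
  rewrite expRN expRD expRM_natl lnK ?posrE//; congr (_ * _)^-1.
  rewrite mulrC expRM_natl expRM_natl lnK ?posrE//.
  by have -> : (4 : R) = 2 ^+ 2 by rewrite expr2 -natrM.
rewrite ler_expR lerN2.
have := bernoulli98 m; have : (0 : R) <= m%:R by [].
move: (m%:R : R) ((9 / 8) ^+ m : R) => a b a0 ab.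
apply: (@le_trans _ _ (2 * L * (1 + a / 8))); last by rewrite ler_pM2l ?mulr_gt0.
nra.
Qed.

Let bad eta n := \bigcup_m \big[setU/set0]_(k < 2 ^ m) big_step eta n m k.

Let mlevel eta n m : measurable (\big[setU/set0]_(k < 2 ^ m) big_step eta n m k).
Proof. exact: bigsetU_measurable. Qed.

Let mbad eta n : measurable (bad eta n).
Proof. exact: bigcupT_measurable. Qed.

Lemma bad_prob eta n : 0 < eta -> (256 <= n)%N ->
  sigma n%:R ^+ 2 <= eta ^+ 2 / (4 * ln n%:R) ->
  (P (bad eta n) <= (4 / n%:R ^+ 2)%:E)%E.
Proof.
move=> eta0 n256 hs.
have n0 : 0 < n%:R :> R by rewrite ltr0n; lia.
have level m : (P (\big[setU/set0]_(k < 2 ^ m) big_step eta n m k) <=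
    (2 / n%:R ^+ 2 * (2 ^+ m)^-1)%:E)%E.
  apply: (le_trans (le_mu_bigsetU P (fun k _ => mbig_step eta n m k))).
  apply: (@le_trans _ _ (\sum_(k < 2 ^ m) (2 / (n%:R ^+ 2 * 4 ^+ m))%:E)%E).
    by apply: lee_sum => k _; exact: big_step_prob.
  rewrite sumEFin lee_fin sumr_const card_ord -[leLHS]mulr_natl natrX.
  have -> : (4 : R) ^+ m = 2 ^+ m * 2 ^+ m by rewrite -exprMn -natrM.
  rewrite le_eqVlt; apply/orP; left; apply/eqP; field.
  by rewrite !gt_eqF// exprn_gt0.
apply: (@le_trans _ _ (\sum_(0 <= m <oo) P (\big[setU/set0]_(k < 2 ^ m) big_step eta n m k))%E).
  by apply: measure_sigma_subadditive.
apply: nneseries_le_cst => [m|N]; first exact: measure_ge0.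
apply: (@le_trans _ _ (\sum_(m < N) (2 / n%:R ^+ 2 * (2 ^+ m)^-1)%:E)%E).
  by apply: lee_sum => m _; exact: level.
rewrite sumEFin lee_fin -big_distrr/=.
have -> : \sum_(m < N) ((2 : R) ^+ m)^-1 = 2 - 2 * (2 ^+ N)^-1.
  elim: (N) => [|N' ih]; first by rewrite big_ord0 expr0 invr1; lra.
  by rewrite big_ord_recr/= ih exprS invfM; field; rewrite gt_eqF// exprn_gt0.
have -> : 4 / n%:R ^+ 2 = 2 / n%:R ^+ 2 * 2 :> R by field; rewrite gt_eqF.
rewrite ler_wpM2l ?divr_ge0 ?exprn_ge0// gerBl mulr_ge0// invr_ge0 exprn_ge0//.
Qed.

Lemma ae_not_bad eta : 0 < eta ->
  {ae P, forall w, exists N, forall n, (N <= n)%N -> ~ bad eta n w}.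
Proof.
move=> eta0.
have e4 : 0 < eta ^+ 2 / 4 by rewrite divr_gt0// exprn_gt0.
have /cvgrPdist_le/(_ _ e4) [M [_ hM]] := sigma_ln.
pose N0 := maxn 256 (Num.truncn M).+1.
have hs n : (N0 <= n)%N -> sigma n%:R ^+ 2 <= eta ^+ 2 / (4 * ln n%:R).
  move=> Nn; have n256 : (256 <= n)%N by rewrite (leq_trans _ Nn)// leq_maxl.
  have Mn : M < n%:R.
    by apply: (lt_le_trans (truncnS_gt M)); rewrite ler_nat (leq_trans _ Nn)// leq_maxr.
  have L0 : 0 < ln n%:R :> R by rewrite ln_gt0// ltr1n; lia.
  have := hM _ Mn; rewrite sub0r normrN => /(le_trans (ler_norm _)) h.
  by rewrite invfM mulrA ler_pdivlMr.
have : P (lim_sup_set (fun n => bad eta (n + N0))) = 0%E.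
  apply: lim_sup_set_cvg0; first by move=> k; exact: mbad.
  apply: (@le_lt_trans _ _ (4 : R)%:E); last exact: ltry.
  apply: nneseries_le_cst => [n|N]; first exact: measure_ge0.
  (* Since [N0] is at least 2, the bounds [4 / (n + N0)%:R ^+ 2] are dominated by a telescoping
     series. *)
  apply: (@le_trans _ _ (\sum_(n < N) (4 / (n + 1)%:R - 4 / (n.+1 + 1)%:R)%:E)%E).
    apply: lee_sum => n _; apply: (le_trans (@bad_prob eta _ eta0 _ _)).
    - by rewrite (leq_trans _ (leq_addl _ _))// leq_maxl.
    - by apply: hs; exact: leq_addl.
    have N2 : (2 <= N0)%N by rewrite /N0 leq_max.
    rewrite lee_fin; have n1 : (0 : R) < (n + 1)%:R by rewrite ltr0n addn1.
    have n2 : (0 : R) < (n.+1 + 1)%:R by rewrite ltr0n addn1.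
    apply: (@le_trans _ _ (4 / (n.+1 + 1)%:R ^+ 2)).
      rewrite ler_pM2l// lef_pV2 ?posrE ?exprn_gt0// ?ltr0n ?addn_gt0 ?(leq_trans _ N2) ?orbT//.
      by rewrite ler_pXn2r ?nnegrE// ler_nat addSnnS leq_add2l.
    have -> : (n.+1 + 1)%:R = (n + 1)%:R + 1 :> R by rewrite addSn natr1.
    move: ((n + 1)%:R : R) n1 => x x0.
    have -> : 4 / x - 4 / (x + 1) = 4 / (x * (x + 1)) by field; rewrite !gt_eqF//; lra.
    by rewrite ler_pM2l// lef_pV2 ?posrE ?exprn_gt0 ?mulr_gt0//; nra.
  rewrite sumEFin lee_fin.
  suff -> : \sum_(n < N) (4 / (n + 1)%:R - 4 / (n.+1 + 1)%:R) = 4 - 4 / (N + 1)%:R :> R.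
    by rewrite gerBl divr_ge0.
  elim: (N) => [|N' ih]; first by rewrite big_ord0 add0n divr1 subrr.
  by rewrite big_ord_recr/= ih; ring.
move=> P0.
exists (lim_sup_set (fun n => bad eta (n + N0))); split => //.
  by apply: bigcap_measurableType => n _; apply: bigcup_measurable => k _; exact: mbad.
move=> w /= /forallNP hw n _.
have := hw (n + N0)%N; move=> /existsNP[m /not_implyP[nm /contrapT bm]].
exists (m - N0)%N => /=; first by rewrite leq_subRL ?(leq_trans (leq_addl _ _) nm)// addnC.
by rewrite subnK// (leq_trans (leq_addl _ _) nm).
Qed.

(** The null set must not depend on [eta], so the countably many values 1 / (12 (k + 1)) are treated
    at once; 12 is the factor 4 of the chaining bound times the factor 3 for passing from unit
    intervals to arbitrary ones. *)
Lemma ae_slow_growth : {ae P, forall w, forall eta, 0 < eta -> exists N : nat,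
  forall s t, N%:R <= s -> s <= t -> `|J t w - J s w| <= eta * (1 + (t - s))}.
Proof.
have e0 k : 0 < (k.+1%:R)^-1 / 12 :> R by rewrite divr_gt0 ?invr_gt0.
apply: filterS2 (ae_foralln (fun k => ae_not_bad (e0 k))) cJ => w hw cw eta eta0.
pose k := Num.truncn eta^-1.
have ke : k.+1%:R^-1 <= eta.
  by rewrite -[leRHS]invrK lef_pV2 ?posrE ?invr_gt0//; exact/ltW/truncnS_gt.
have [N hN] := hw k.
have /continuous_within_itvcyP[cw0 _] := cw.
set e := _ / 12 in hN; have e_gt0 : 0 < e by exact: e0.
have step n m i : (N.+1 <= n)%N -> (i < 2 ^ m)%N ->
    `|J (dyad R m (n * 2 ^ m + i).+1) w - J (dyad R m (n * 2 ^ m + i)) w|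
      <= e * (3 / 4) ^+ m.
  move=> Nn im; apply: ltW; rewrite ltNge; apply/negP => h.
  apply: (hN n (ltnW Nn)); exists m => //.
  by rewrite -bigcup_mkord; exists i.
(* Starting from [N.+1] keeps the interval away from 0, where the path is only known to be
   continuous from the right. *)
have chain n t : (N.+1 <= n)%N -> n%:R <= t -> t < n.+1%:R ->
    `|J t w - J n%:R w| <= 4 * e.
  move=> Nn nt tn; apply: (@chaining_bound R (J ^~ w) n e) => //.
  - exact: ltW.
  - move=> u nu; apply: cw0; rewrite in_itv/= andbT (lt_le_trans _ nu)// ltr0n.
    exact: leq_trans Nn.
  - by move=> m i; exact: step.
exists N.+1 => s t Ns st.
have := @slow_growth_of_unit_steps R (J ^~ w) N.+1 (4 * e) _ chain _ s t Ns st.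
move=> /(_ _ _)/le_trans; apply.
- by rewrite mulr_ge0// ltW.
- move=> n Nn; have := step n 0%N 0%N Nn.
  rewrite expn0 muln1 addn0 expr0 mulr1 !dyad0 => /(_ isT) h.
  by apply: (le_trans h); lra.
- have ts : 0 <= 1 + (t - s) by lra.
  rewrite ler_wpM2r//; apply: le_trans ke.
  have -> : 3 * (4 * e) = e * 12 by ring.
  by rewrite /e divfK.
Qed.

End almost_sure_slow_growth.

(** * The perturbed differential equation *)

Section crossing.
Context (R : realType).
Implicit Types (y : R -> R) (p q a b : R).

Lemma last_exit y p q a : p <= q -> (forall u, p <= u -> {for u, continuous y}) ->
  y p <= a -> exists s, [/\ p <= s, s <= q, y s <= a &
    forall u, s < u -> u <= q -> a < y u].
Proof.
move=> pq cy yp; pose S := [set u | [/\ p <= u, u <= q & y u <= a]].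
have Sp : S p by split.
have Sub : ubound S q by move=> u [].
have Sup : has_sup S by split; [exists p|exists q].
have ps : p <= sup S by apply: ub_le_sup => //; exists q.
exists (sup S); split => //.
- by apply: ge_sup => //; exists p.
- rewrite leNgt; apply/negP => ays.
  have : \forall u \near sup S, a < y u by exact: (cvgr_gt _ (cy _ ps)).
  move=> /nbhs_ballP[r /= r0 hr].
  have [u Su su] := sup_adherent r0 Sup.
  have us : u <= sup S by apply: ub_le_sup => //; exists q.
  have /hr : ball (sup S) r u.
    by rewrite /ball/= ger0_norm ?subr_ge0// ltrBlDr addrC -ltrBlDr.
  by case: Su => _ _; rewrite ltNge => ->.
- move=> u su uq; have pu := le_trans ps (ltW su).
  rewrite ltNge; apply/negP => yu; move: su; rewrite ltNge => /negP; apply.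
  by apply: ub_le_sup => //; exists q.
Qed.

(** Take for [t] the first time at which [y] reaches [b], and for [s] the last time before it at
    which [y] is at most [a]. *)
Lemma crossing_interval y p q a b : p <= q -> a < b ->
  (forall u, p <= u -> {for u, continuous y}) -> y p <= a -> b <= y q ->
  exists s t, [/\ p <= s, s <= t, y s <= a, b <= y t &
    forall u, s < u -> u < t -> a < y u < b].
Proof.
move=> pq ab cy yp yq.
have [t [pt tq yt ht]] : exists t, [/\ p <= t, t <= q, b <= y t &
    forall u, p <= u -> u < t -> y u < b].
  pose S := [set u | [/\ p <= u, u <= q & b <= y u]].
  have Sq : S q by split.
  have Slb : lbound S p by move=> u [].
  have Sinf : has_inf S by split; [exists q|exists p].
  have pS : p <= inf S by apply: lb_le_inf => //; exists q.
  have infSle u : S u -> inf S <= u by move=> Su; apply: ge_inf => //; exists p.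
  exists (inf S); split => //; first exact: infSle.
  - rewrite leNgt; apply/negP => yb.
    have : \forall u \near inf S, y u < b by exact: (cvgr_lt _ (cy _ pS)).
    move=> /nbhs_ballP[r /= r0 hr].
    have [u Su us] := inf_adherent r0 Sinf.
    have /hr : ball (inf S) r u.
      rewrite /ball/= distrC ger0_norm ?subr_ge0 ?infSle//.
      by rewrite ltrBlDr addrC.
    by case: Su => _ _ byu; rewrite ltNge byu.
  - move=> u pu uS; rewrite ltNge; apply/negP => yu.
    move: (uS); rewrite ltNge => /negP; apply; apply: (infSle u); split => //.
    by have := infSle _ Sq; lra.
have [s [ps st ys hs]] := last_exit pt cy yp.
exists s, t; split => // u su ut; rewrite hs ?ltW//= ht//.
exact: le_trans ps (ltW su).
Qed.

End crossing.

(** * Paths with a restoring drift and a slowly growing perturbation *)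

Section perturbed_flow.
Context (R : realType).
Variables (f x j : R -> R).
Hypothesis cf : continuous f.
Hypothesis f_gt0 : forall y, 0 < y -> 0 < f y.
Hypothesis cx : forall u, 0 < u -> {for u, continuous x}.
Hypothesis drift : forall s t c, 0 <= s -> s <= t ->
  (forall u, s < u -> u < t -> c <= f (x u)) ->
  x t - x s <= - c * (t - s) + (j t - j s).
Hypothesis slow : forall eta, 0 < eta -> exists N : nat,
  forall s t, N%:R <= s -> s <= t -> `|j t - j s| <= eta * (1 + (t - s)).
Hypothesis jNy : ~ (j n%:R @[n --> \oo] --> +oo).

Lemma slow_pos eta : 0 < eta -> exists N : nat, (0 < N)%N /\
  forall s t, N%:R <= s -> s <= t -> j t - j s <= eta * (1 + (t - s)).
Proof.
move=> /slow[N hN]; exists N.+1; split => // s t Ns st.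
rewrite (le_trans (ler_norm _))// hN// (le_trans _ Ns)// ler_nat; exact: leqW.
Qed.

Lemma f_lower_bound a b : 0 < a -> a <= b ->
  exists2 c, 0 < c & forall y, a <= y -> y <= b -> c <= f y.
Proof.
move=> a0 ab; have cfab : {within `[a, b], continuous f}.
  by apply: continuous_subspaceT => y; exact: cf.
have [c cab hc] := EVT_min ab cfab; exists (f c).
  by apply: f_gt0; move: cab; rewrite in_itv/= => /andP[/(lt_le_trans a0)].
by move=> y ay yb; apply: hc; rewrite in_itv/= ay.
Qed.

(* An upcrossing of [a, b] takes at least c times its length away from x, which
   the slow growth of j cannot make up for. *)
Lemma stays_below a b : 0 < a -> a < b -> exists N : nat, (0 < N)%N /\
  forall s t, N%:R <= s -> s <= t -> x s <= a -> x t <= b.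
Proof.
move=> a0 ab; have [c c0 hc] := f_lower_bound a0 (ltW ab).
(* The bound by [c] lets the drift absorb the part of the growth proportional to time; what is left
   is at most half of the gap to be crossed. *)
pose eta := Num.min c ((b - a) / 2).
have eta0 : 0 < eta by rewrite lt_min c0 divr_gt0// subr_gt0.
have [N [N0 hN]] := slow_pos eta0; exists N; split => // p q Np pq xp.
have N0' : 0 < N%:R :> R by rewrite ltr0n.
rewrite leNgt; apply/negP => /ltW xq.
have cxp u : p <= u -> {for u, continuous x}.
  by move=> pu; apply: cx; apply: lt_le_trans pu; exact: lt_le_trans Np.
have [s [t [ps st xs xt hst]]] := crossing_interval pq ab cxp xp xq.
have s0 : 0 <= s by rewrite (le_trans _ ps)// (le_trans _ Np)// ltW.
have dr : x t - x s <= - c * (t - s) + (j t - j s).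
  apply: drift => // u su ut.
  by have /andP[h1 h2] := hst u su ut; apply: hc; exact: ltW.
have := hN s t (le_trans Np ps) st.
have ec : eta <= c by rewrite /eta ge_min lexx.
have eb : eta <= (b - a) / 2 by rewrite /eta ge_min lexx orbT.
have ts : 0 <= t - s by rewrite subr_ge0.
have : eta * (t - s) <= c * (t - s) by rewrite ler_wpM2r.
lra.
Qed.

(** While [x] stays above [a] it grows no faster than [j], which is below some fixed level at
    arbitrarily late integers; there [x] is at most some [K], and afterwards it remains below
    [K + 1]. On the compact range from [a] to [K + 1] the drift is at least some [c > 0], and it
    brings [x] down below [a]. *)
Lemma returns_below a (N : nat) : 0 < a -> exists2 t, N%:R <= t & x t <= a.
Proof.
move=> a0; apply: contrapT => H.
have xa t : N%:R <= t -> a < x t.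
  by move=> Nt; rewrite ltNge; apply/negP => xt; apply: H; exists t.
have [A hA] : exists A, forall M : nat, exists2 n, (M <= n)%N & j n%:R < A.
  apply: contrapT => /forallNP nA; apply: jNy; apply/cvgryPge => A.
  have := nA A => /existsNP[M hM]; exists M => // n /= Mn.
  by rewrite leNgt; apply/negP => jA; apply: hM; exists n.
pose K := Num.max a (A + x N%:R - j N%:R).
have aK : a <= K by rewrite le_max lexx.
have K0 : 0 < K by exact: lt_le_trans aK.
have KK1 : K < K + 1 by rewrite ltrDl.
have [N1 [N10 stay]] := stays_below K0 KK1.
have [c c0 hc] := f_lower_bound a0 (ltW (le_lt_trans aK KK1)).
have c2 : 0 < c / 2 by rewrite divr_gt0.
have [N2 [_ hN2]] := slow_pos c2.
have [n nM jA] := hA (maxn N (maxn N1 N2)).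
have Nn : N%:R <= n%:R :> R by rewrite ler_nat (leq_trans _ nM)// leq_maxl.
have N1n : N1%:R <= n%:R :> R.
  by rewrite ler_nat (leq_trans _ nM)// (leq_trans _ (leq_maxr _ _))// leq_maxl.
have N2n : N2%:R <= n%:R :> R.
  by rewrite ler_nat (leq_trans _ nM)// (leq_trans _ (leq_maxr _ _))// leq_maxr.
have xn : x n%:R <= K.
  have := @drift N%:R n%:R 0 (ler0n _ _) Nn.
  rewrite oppr0 mul0r add0r => dr.
  rewrite le_max; apply/orP; right.
  suff : x n%:R - x N%:R <= j n%:R - j N%:R by lra.
  apply: dr => u Nu un; apply/ltW/f_gt0/(lt_trans a0)/xa; exact: ltW.
(* Over this time the drift takes away at least [c + 2 * K] while [j], growing at rate [c / 2],
   returns at most [c + K]; hence [x t <= 0]. *)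
pose t := n%:R + 1 + 2 * K / c.
have Kc : 0 <= 2 * K / c by rewrite divr_ge0 ?mulr_ge0 ?ltW.
have nt : n%:R <= t by rewrite /t; lra.
have dr : x t - x n%:R <= - c * (t - n%:R) + (j t - j n%:R).
  apply: drift => // u nu ut; apply: hc.
    by apply/ltW/xa/(le_trans Nn)/ltW.
  by apply: (stay n%:R u) => //; exact: ltW.
have js := hN2 n%:R t N2n nt.
have : a < x t by apply: xa; exact: le_trans nt.
have E : c * (t - n%:R) = c + 2 * K by rewrite /t; field; rewrite gt_eqF.
have E2 : c / 2 * (t - n%:R) = c / 2 + K by rewrite /t; field; rewrite gt_eqF.
rewrite mulrDr mulr1 E2 in js; rewrite mulNr E in dr; lra.
Qed.

Lemma eventually_below e : 0 < e -> \forall t \near +oo, x t <= e.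
Proof.
move=> e0; have e2 : 0 < e / 2 by rewrite divr_gt0.
have ee : e / 2 < e by lra.
have [N [_ stay]] := stays_below e2 ee.
have [t Nt xt] := returns_below N e2.
exists t; split; first exact: num_real.
by move=> u tu; apply: (stay t u) => //; exact: ltW.
Qed.

End perturbed_flow.

(** * Drift bounds from the integral equation *)

Section integral_equation.
Context (R : realType).
Variables (f x j : R -> R) (xi : R).
Hypothesis cf : continuous f.
Hypothesis cx : {within `[0, +oo[, continuous x}.
Hypothesis eqx : forall t, 0 <= t ->
  x t = xi - (\int[lebesgue_measure]_(s in `[0, t]) f (x s)) + j t.

Let integrable_fx t : 
  lebesgue_measure.-integrable `[0, t] (EFin \o (fun s => f (x s))).
Proof.
apply: continuous_compact_integrable; first exact: segment_compact.
have cx0 : {within `[0, t], continuous x}.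
  by apply: continuous_subspaceW cx => u /=; rewrite !in_itv/= andbT => /andP[].
by move=> u; apply: continuous_comp; [exact: cx0|exact: cf].
Qed.

(** The open interval is chosen because a crossing gives bounds on the path only strictly between
    its two end times. *)
Lemma drift_increment s t : 0 <= s -> s <= t ->
  x t - x s = - (\int[lebesgue_measure]_(u in `]s, t[) f (x u)) + (j t - j s).
Proof.
move=> s0 st; have t0 := le_trans s0 st.
rewrite Rintegral_itv_bndo_bndc; last first.
  apply: integrableS (integrable_fx t) => //.
  move=> u /=; rewrite !in_itv/= => /andP[su ut].
  by rewrite (ltW ut) (le_trans s0 (ltW su)).
rewrite -(@Rintegral_itvB _ _ (BLeft 0) (BRight t) s)//.
  by rewrite (eqx s0) (eqx t0); lra.
Qed.

Let integrable_sub (s t : R) (g : R -> R) : lebesgue_measure.-integrable `[s, t] (EFin \o g) ->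
  lebesgue_measure.-integrable `]s, t[ (EFin \o g).
Proof.
apply: integrableS => // u /=; rewrite !in_itv/= => /andP[/ltW -> /ltW ->//].
Qed.

Let integrable_oo s t : 0 <= s ->
  lebesgue_measure.-integrable `]s, t[ (EFin \o (fun s => f (x s))).
Proof.
move=> s0; apply: integrableS (integrable_fx t) => // u /=.
by rewrite !in_itv/= => /andP[su ut]; rewrite (ltW ut) (le_trans s0 (ltW su)).
Qed.

Let integrable_cst_oo s t (c : R) :
  lebesgue_measure.-integrable `]s, t[ (EFin \o (fun=> c)).
Proof.
apply: integrable_sub; apply: continuous_compact_integrable.
  exact: segment_compact.
by move=> u; exact: cvg_cst.
Qed.

Let Rintegral_cst_oo s t (c : R) : s <= t ->
  \int[lebesgue_measure]_(u in `]s, t[) c = c * (t - s).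
Proof.
move=> st; have mu_st : lebesgue_measure (`]s, t[ : set R) = (t - s)%:E.
  rewrite lebesgue_measure_itv/= lte_fin; case: ltP => [_|ts].
    by rewrite -EFinB.
  have -> : t = s by apply/eqP; rewrite eq_le st ts.
  by rewrite subrr.
by rewrite Rintegral_cst//; congr (_ * _); rewrite -[RHS]/(fine (t - s)%:E) -mu_st.
Qed.

Lemma drift_le s t c : 0 <= s -> s <= t ->
  (forall u, s < u -> u < t -> c <= f (x u)) ->
  x t - x s <= - c * (t - s) + (j t - j s).
Proof.
move=> s0 st hc; rewrite drift_increment// lerD2r mulNr lerN2 -Rintegral_cst_oo//.
apply: le_Rintegral => //; first exact: integrable_oo.
by move=> u /=; rewrite in_itv/= => /andP[su ut]; exact: hc.
Qed.

Lemma drift_ge s t c : 0 <= s -> s <= t ->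
  (forall u, s < u -> u < t -> f (x u) <= c) ->
  - c * (t - s) + (j t - j s) <= x t - x s.
Proof.
move=> s0 st hc; rewrite drift_increment// lerD2r mulNr lerN2 -Rintegral_cst_oo//.
apply: le_Rintegral => //; first exact: integrable_oo.
by move=> u /=; rewrite in_itv/= => /andP[su ut]; exact: hc.
Qed.

End integral_equation.

(** * The equivalence *)

Section integral_process.
Context (R : realType) (d : measure_display) (T : measurableType d)
  (P : probability T R) (F : R -> set (set T)) (B J : R -> T -> R)
  (sigma : R -> R).
Hypothesis hF : complete_filtration P F.
Hypothesis hB : brownian_motion P B.
Hypothesis hsigma : {within `[0, +oo[, continuous sigma}.
Hypothesis hsigma_decr :
  forall s t, 0 <= s -> s <= t -> sigma t ^+ 2 <= sigma s ^+ 2.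
Hypothesis hJ : stochastic_integral P F B sigma J.

Let mJ t : 0 <= t -> measurable_fun setT (J t).
Proof. by apply: (adapted_measurable hF); case: hJ. Qed.

Lemma dyadic_incr_mgf_le m l x :
  (\int[P]_w (expR (x * (J (dyad R m l.+1) w - J (dyad R m l) w)))%:E <=
   (expR (x ^+ 2 * (sigma (dyad R m l) ^+ 2 / 2 ^+ m) / 2))%:E)%E.
Proof.
have h0 : 0 < ((2 : R) ^+ m)^-1 by rewrite invr_gt0 exprn_gt0.
have [v [hv mgf]] := stochastic_integral_mgf hF hB hsigma hsigma_decr hJ h0.
have := incr_mgf (D := fun l w => J (dyad R m l.+1) w - J (dyad R m l) w) mgf l x.
move=> ->; rewrite lee_fin ler_expR ler_pM2r ?invr_gt0// ler_wpM2l ?sqr_ge0//.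
by have /andP[] := hv l.
Qed.

Lemma unit_incr_mgf : exists v : nat -> R,
  (forall l, sigma l.+1%:R ^+ 2 <= v l <= sigma l%:R ^+ 2) /\
  forall (a : nat -> R) (L : nat),
    (\int[P]_w (expR (\sum_(l < L) a l * (J l.+1%:R w - J l%:R w)))%:E
     = (expR (\sum_(l < L) a l ^+ 2 * v l / 2))%:E)%E.
Proof.
have [v [hv mgf]] := stochastic_integral_mgf hF hB hsigma hsigma_decr hJ (@ltr01 R).
exists v; split=> [l|a L]; first by have := hv l; rewrite !mulr1.
rewrite -mgf; apply: eq_integral => w _; congr (expR _)%:E.
by apply: eq_bigr => l _; rewrite !mulr1.
Qed.

(** The values 1 and -1 of [e] exclude the two infinite limits. *)
Lemma ae_not_cvgy (e : R) :
  {ae P, forall w, ~ (e * J n%:R w @[n --> \oo] --> +oo)}.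
Proof.
have [v [hv mgf]] := unit_incr_mgf.
have v0 l : 0 <= v l by have /andP[h _] := hv l; rewrite (le_trans _ h)// sqr_ge0.
pose D l w := J l.+1%:R w - J l%:R w.
have mD l : measurable_fun setT (D l).
  by apply: measurable_funB; apply: mJ.
have := @gaussian_walk_not_cvgy R d T P (fun n w => e * \sum_(l < n) D l w)
  (fun n => e ^+ 2 * \sum_(l < n) v l).
move=> /(_ _ _ _ _)/filterS; apply.
- move=> w + Jy; apply.
  (* The walk made of the increments is [J] minus its value at 0, hence the shift of the level. *)
  apply/cvgryPge => A; move/cvgryPge : Jy => /(_ (A + e * J 0 w)).
  apply: filterS => n; have := telescope_sumr (fun n => J n%:R w) (leq0n n).
  by rewrite big_mkord /D => ->; lra.
- by move=> i; apply: measurable_funM => //; exact: measurable_sum.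
- by move=> i; rewrite mulr_ge0 ?sqr_ge0// sumr_ge0.
- move=> i k ik; rewrite ler_wpM2l ?sqr_ge0// -(subnKC ik) big_split_ord/=.
  by rewrite lerDl sumr_ge0.
- move=> i k x y ik.
  under eq_integral do rewrite !mulrA.
  rewrite (walk_mgf mgf (x * e) (y * e) ik).
  by congr (expR _)%:E; ring.
Qed.

End integral_process.

Section main.
Context (R : realType) (d : measure_display) (T : measurableType d)
  (P : probability T R) (F : R -> set (set T)) (B : R -> T -> R)
  (f sigma : R -> R) (xi : R) (X : R -> T -> R).
Hypothesis hF : complete_filtration P F.
Hypothesis hB : brownian_motion P B.
Hypothesis hf : continuous f.
Hypothesis hf_sign : forall x, x != 0 -> 0 < x * f x.
Hypothesis hf0 : f 0 = 0.
Hypothesis hsigma : {within `[0, +oo[, continuous sigma}.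
Hypothesis hsigma_decr :
  forall s t, 0 <= s -> s <= t -> sigma t ^+ 2 <= sigma s ^+ 2.
Hypothesis hX : sde_solution P F B f sigma xi X.

Lemma fading_cvg0 : sigma t ^+ 2 * ln t @[t --> +oo] --> 0 ->
  {ae P, forall w, X t w @[t --> +oo] --> 0}.
Proof.
move=> hA; have [aX cX [J hJ eqX]] := hX.
have cJ : continuous_process P J by case: hJ.
have mJ t : 0 <= t -> measurable_fun setT (J t).
  by apply: (adapted_measurable hF); case: hJ.
have slow := ae_slow_growth mJ cJ hsigma_decr
  (dyadic_incr_mgf_le hF hB hsigma hsigma_decr hJ) hA.
have ny1 := ae_not_cvgy hF hB hsigma hsigma_decr hJ 1.
have ny2 := ae_not_cvgy hF hB hsigma hsigma_decr hJ (-1).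
near=> w.
have eqw : forall t, 0 <= t ->
  X t w = xi - (\int[lebesgue_measure]_(s in `[0, t]) f (X s w)) + J t w.
  by near: w.
have cw : {within `[0, +oo[, continuous (X ^~ w)} by near: w.
have slw : forall eta, 0 < eta -> exists N : nat,
  forall s t, N%:R <= s -> s <= t -> `|J t w - J s w| <= eta * (1 + (t - s)).
  by near: w.
have n1 : ~ (1 * J n%:R w @[n --> \oo] --> +oo) by near: w.
have n2 : ~ (-1 * J n%:R w @[n --> \oo] --> +oo) by near: w.
have cx u : 0 < u -> {for u, continuous (X ^~ w)}.
  have /continuous_within_itvcyP[cw0 _] := cw.
  by move=> u0; apply: cw0; rewrite in_itv/= u0.
have up : forall e, 0 < e -> \forall t \near +oo, X t w <= e.
  apply: (@eventually_below R f (X ^~ w) (J ^~ w)) => //.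
  - by move=> y y0; rewrite -(pmulr_rgt0 _ y0) hf_sign// gt_eqF.
  - by move=> s t c; exact: (drift_le hf cw eqw).
  - by move=> h; apply: n1; under eq_fun do rewrite mul1r.
(* The reflected path solves the equation with drift function [y |-> - f (- y)], of the same sign
   type, and perturbation [- J]. *)
have down : forall e, 0 < e -> \forall t \near +oo, - X t w <= e.
  apply: (@eventually_below R (fun y => - f (- y)) (fun t => - X t w)
    (fun t => - J t w)) => //.
  - move=> y; apply: cvgN; apply: (cvg_comp (fun y => - y) f); last exact: hf.
    by apply: cvgN; exact: cvg_id.
  - move=> y y0; rewrite -(pmulr_rgt0 _ y0) mulrN -mulNr hf_sign//.
    by rewrite oppr_eq0 gt_eqF.
  - by move=> u u0; apply: cvgN; exact: cx.
  - move=> s t c s0 st hc.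
    have := @drift_ge R f (X ^~ w) (J ^~ w) xi hf cw eqw s t (- c) s0 st.
    move=> /(_ _)H; suff : - - c * (t - s) + (J t w - J s w) <= X t w - X s w by lra.
    apply: H => u su ut; have := hc u su ut; rewrite opprK; lra.
  - move=> eta /slw[N hN]; exists N => s t Ns st.
    have -> : - J t w - - J s w = - (J t w - J s w) by ring.
    by rewrite normrN hN.
  - by move=> h; apply: n2; under eq_fun do rewrite mulN1r.
apply/cvgrPdist_le => e e0.
near=> t; rewrite sub0r normrN ler_norml; apply/andP; split.
  by rewrite lerNl; near: t; exact: down.
by near: t; exact: up.
Unshelve. all: by end_near.
Qed.

Lemma cvg0_fading : {ae P, forall w, X t w @[t --> +oo] --> 0} ->
  sigma t ^+ 2 * ln t @[t --> +oo] --> 0.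
Proof.
move=> hX0; have [aX cX [J hJ eqX]] := hX.
have mJ t : 0 <= t -> measurable_fun setT (J t).
  by apply: (adapted_measurable hF); case: hJ.
have [v [hv mgf]] := unit_incr_mgf hF hB hsigma hsigma_decr hJ.
pose D l w := J l.+1%:R w - J l%:R w.
have mD l : measurable_fun setT (D l) by apply: measurable_funB; apply: mJ.
apply: (fading_of_bounded_weights hsigma_decr hv) => K m K0 vp vK.
apply: (@small_incr_bounded R d T P D v mD mgf K m K0 vp vK).
apply: filterS3 hX0 cX eqX => w X0 cw eqw.
have fX0 : f (X t w) @[t --> +oo] --> 0.
  by rewrite -hf0; apply: (cvg_comp _ f X0); exact: hf.
(* An increment of [J] over a unit interval is that of [X] plus the integral of [f (X)]; the three
   thirds are for the two values of [X] and for this integral. *)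
apply/cvgrPdist_le => e e0; have e3 : 0 < e / 3 by rewrite divr_gt0.
have /cvgrPdist_le/(_ _ e3)[M1 [_ h1]] := X0.
have /cvgrPdist_le/(_ _ e3)[M2 [_ h2]] := fX0.
exists (Num.truncn (Num.max M1 M2)).+1 => // n /= Mn.
have nM : Num.max M1 M2 < n%:R.
  by apply: (lt_le_trans (truncnS_gt _)); rewrite ler_nat.
have nM1 : M1 < n%:R by apply: le_lt_trans nM; rewrite le_max lexx.
have nM2 : M2 < n%:R by apply: le_lt_trans nM; rewrite le_max lexx orbT.
have nn : n%:R <= n.+1%:R :> R by rewrite ler_nat.
have := h1 _ nM1; have := h1 _ (lt_le_trans nM1 nn).
rewrite !sub0r !normrN !ler_norml => /andP[a1 a2] /andP[b1 b2].
have fb u : n%:R < u -> - (e / 3) <= f (X u w) <= e / 3.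
  by move=> nu; have := h2 _ (lt_trans nM2 nu); rewrite sub0r normrN ler_norml.
have dl : X n.+1%:R w - X n%:R w <= - - (e / 3) * (n.+1%:R - n%:R) +
    (J n.+1%:R w - J n%:R w).
  apply: (drift_le hf cw eqw) => // u nu _.
  by have /andP[] := fb u nu.
have dg : - (e / 3) * (n.+1%:R - n%:R) + (J n.+1%:R w - J n%:R w) <=
    X n.+1%:R w - X n%:R w.
  apply: (drift_ge hf cw eqw) => // u nu _.
  by have /andP[] := fb u nu.
have n1 : n.+1%:R - n%:R = 1 :> R by rewrite -natr1 addrAC subrr add0r.
rewrite n1 !mulr1 in dl dg.
by apply/andP; split; rewrite /D; lra.
Qed.

End main.

Theorem theorem11 (R : realType) (d : measure_display) (T : measurableType d)
  (P : probability T R) (F : R -> set (set T)) (B : R -> T -> R)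
  (f sigma : R -> R) (X : R -> R -> T -> R)
  (hF : complete_filtration P F)
  (hB : brownian_motion P B) (hBF : adapted F B)
  (hf : continuous f) (hf_sign : forall x, x != 0 -> 0 < x * f x)
  (hf0 : f 0 = 0)
  (hsigma : {within `[0, +oo[, continuous sigma})
  (hsigma_decr : forall s t, 0 <= s -> s <= t -> sigma t ^+ 2 <= sigma s ^+ 2)
  (hX : forall xi, sde_solution P F B f sigma xi (X xi)) :
  (sigma t ^+ 2 * ln t @[t --> +oo] --> 0) <->
  (forall xi, {ae P, forall w, X xi t w @[t --> +oo] --> 0}).
Proof.
split=> [hA xi|hB0].
  exact: (fading_cvg0 hF hB hf hf_sign hsigma hsigma_decr (hX xi)).
exact: (cvg0_fading hF hB hf hf0 hsigma hsigma_decr (hX 0)).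
Qed.
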